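(* Let $\mathbb{G}\subset C_b(E)\times B(\mathbb{R}_+\times\Omega\times U\times E)$ be a generator such that, for every $(f,g)\in\mathbb{G}$, $g$ is uniformly bounded and the map $(\mathbf{x},x)\mapsto g(t,\mathbf{x},u,x)$ is continuous on $\Omega\times E$ for each $t\in\mathbb{R}_+$ and $u\in U$. Let $(m^n)_{n\ge1}\subset\mathcal{U}^*$ be such that $m^n\to m^\infty\in\mathcal{U}^*$, $\mathbb{P}^*$-a.s., and let $\overline{\mathbb{P}}^*_n\in\overline{\mathcal{P}}(m^n)$ for all $n\ge1$. Assume in addition that $\overline{\mathbb{P}}^*_n\to\overline{\mathbb{P}}^*_\infty$ for the stable convergence topology, and that for all $(f,g)\in\mathbb{G}$, all $s\le t$ and all bounded $\overline{\mathcal{F}}^*_s$-measurable random variables $\xi$, $$\mathbb{E}^{\overline{\mathbb{P}}^*_n}\Big[\Big(\int_s^t\!\!\int_Ug(r,X_{r\wedge\cdot},u,X_r)\big(m^n_r(du)-m^\infty_r(du)\big)dr\Big)\xi\Big]\longrightarrow0,\qquad n\to\infty.$$ Then $\overline{\mathbb{P}}^*_\infty\in\overline{\mathcal{P}}(m^\infty)$.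
   Context: $E,U$ are nonempty Polish spaces; $\Omega=\mathbb{D}(\mathbb{R}_+,E)$ is the space of càdlàg paths with the Skorokhod topology and canonical filtration $\mathbb{F}=(\mathcal{F}_t)$, $\mathcal F_\infty=\bigvee_t\mathcal F_t$. $(\Omega^*,\mathcal{F}^*,\mathbb{F}^*=(\mathcal{F}^*_t)_{t\ge0},\mathbb{P}^* )$ is a fixed filtered probability space. $\overline\Omega^*:=\Omega^*\times\Omega$, $\overline{\mathcal{F}}^*_\infty:=\mathcal{F}^*\otimes\mathcal{F}_\infty$, $\overline{\mathbb{F}}^*=(\overline{\mathcal{F}}^*_t)$ with $\overline{\mathcal{F}}^*_t:=\mathcal{F}^*_t\otimes\mathcal{F}_t$; $X_t(\omega^*,\omega):=\omega_t$. The stable convergence topology on probability measures on $(\overline\Omega^*,\overline{\mathcal{F}}^*_\infty)$ is the coarsest one making $\overline{\mathbb{P}}\mapsto\mathbb{E}^{\overline{\mathbb{P}}}[\xi]$ continuous for every bounded $\overline{\mathcal{F}}^*_\infty$-measurable $\xi$ such that $\mathbf{x}\mapsto\xi(\omega^*,\mathbf{x})$ is continuous for every $\omega^*$. $\mathcal{U}^*$ is the set of $\mathbb{F}^*$-predictable processes $m=(m_t)_{t\ge0}$ valued in the Borel probability measures on $U$ (also viewed as processes on $\overline\Omega^*$); each is identified with the random measure $m(dt,du)=m_t(du)dt$ on $\mathbb{R}_+\times U$, and $m^n\to m$ means $\int\!\!\int\phi(t,u)e^{-t}m^n(dt,du)\to\int\!\!\int\phi(t,u)e^{-t}m(dt,du)$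 for all $\phi\in C_b(\mathbb{R}_+\times U)$. $B(\mathbb{R}_+\times\Omega\times U\times E)$ is the set of measurable $g:\mathbb{R}_+\times\Omega\times U\times E\to\mathbb{R}$ with $\int_0^T\sup_u|g(t,\mathbf{x}_{t\wedge\cdot},u,\mathbf{x}_t)|dt<\infty$ for all $T\ge 0$, $\mathbf{x}\in\Omega$. Fix $x_0\in E$. For $m\in\mathcal{U}^*$, $\overline{\mathcal{P}}(m)$ (relaxed control rules with control process $m$) is the set of probabilities $\overline{\mathbb{P}}$ on $\overline\Omega^*$ with marginal $\overline{\mathbb{P}}|_{\Omega^*}=\mathbb{P}^*$, $\overline{\mathbb{P}}[X_0=x_0]=1$, and such that for every $(f,g)\in\mathbb{G}$ the process $f(X_t)-\int_0^t\int_Ug(s,X_{s\wedge\cdot},u,X_s)m_s(du)ds$, $t\ge0$, is a $(\overline{\mathbb{P}},\overline{\mathbb{F}}^* )$-martingale. *)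

(* Defs.v *)
From HB Require Import structures.
From mathcomp Require Import all_boot all_order all_algebra.
From mathcomp Require Import all_classical all_reals all_analysis.

Set Implicit Arguments.
Unset Strict Implicit.
Unset Printing Implicit Defensive.

Import Order.TTheory GRing.Theory Num.Theory.
Import numFieldNormedType.Exports.

Local Open Scope classical_set_scope.
Local Open Scope ring_scope.

(** Nonempty Polish spaces, given with a compatible complete metric.  All the
    notions below depend on the topology only (for the Skorokhod topology this
    is the classical independence of the metric). *)
HB.mixin Record isSeparable (T : Type) & Topological T := {
  separable_subproof : exists2 D : set T, countable D & dense D }.

#[short(type="polishType")]
HB.structure Definition Polish (R : realType) :=
  { T of PseudoPointedMetric R T & Metric R T & Complete T & isSeparable T }.

Notation borel T := (g_sigma_algebraType (@open T)).

Definition bounded_on {T : Type} {R : realType} (D : set T) (f : T -> R) :=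
  exists M : R, forall x, D x -> `|f x| <= M.

Section cadlag_paths.
Context {R : realType} (E : polishType R).

(** A path on [R_+] is represented by its extension to [R] that is constant on
    the negative half-line. *)
Definition cadlag (x : R -> E) : Prop :=
  [/\ forall t : R, t < 0 -> x t = x 0,
      forall t : R, 0 <= t -> x s @[s --> t^'+] --> x t
    & forall t : R, 0 < t -> exists l : E, x s @[s --> t^'-] --> l].

Record skorokhod : Type := Skorokhod {
  path :> R -> E ;
  path_cadlag : cadlag path }.

Lemma cadlag_cst (e : E) : cadlag (cst e).
Proof. by split=> // t _; [|exists e]; exact: cvg_cst. Qed.

HB.instance Definition _ := gen_eqMixin skorokhod.
HB.instance Definition _ := gen_choiceMixin skorokhod.
HB.instance Definition _ := isPointed.Build skorokhod (Skorokhod (cadlag_cst point)).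

Lemma cadlag_stopped (x : skorokhod) (t : R) :
  cadlag (fun s => x (Num.min t s)).
Proof.
case: x => x [/= xneg xr xl].
have xle0 s : s <= 0 -> x s = x 0.
  by rewrite le_eqVlt => /orP[/eqP->//|/xneg].
have const (F : set_system R) : Filter F -> (\forall r \near F, t <= r) ->
    x (Num.min t r) @[r --> F] --> x t.
  move=> FF tF; apply: cvg_near_cst; near=> r.
  have tr : t <= r by near: r.
  by rewrite min_l.
have follow (F : set_system R) (l : E) : Filter F ->
    (\forall r \near F, r <= t) -> x r @[r --> F] --> l ->
    x (Num.min t r) @[r --> F] --> l.
  move=> FF tF; apply: cvg_trans; apply: near_eq_cvg; near=> r.
  have tr : r <= t by near: r.
  by rewrite min_r.
split=> s s0.
- by rewrite !xle0 ?ge_min ?lexx ?(ltW s0) ?orbT.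
- rewrite /=; case: (ltP s t) => st.
    refine (follow s^'+ (x s) _ _ (xr s s0)).
    by near=> r; apply/ltW; near: r; exact: nbhs_right_lt.
  refine (const s^'+ _ _).
  by near=> r; apply/(le_trans st)/ltW; near: r; exact: nbhs_right_gt.
- rewrite /=; case: (leP s t) => st.
    have [l xsl] := xl s s0; exists l; refine (follow s^'- l _ _ xsl).
    by near=> r; apply: (le_trans _ st); apply/ltW; near: r; exact: nbhs_left_lt.
  exists (x t); refine (const s^'- _ _).
  by near=> r; apply/ltW; near: r; exact: nbhs_left_gt.
Unshelve. all: by end_near. Qed.

Definition stopped (t : R) (x : skorokhod) : skorokhod :=
  Skorokhod (cadlag_stopped x t).

Definition time_change (l : R -> R) : Prop :=
  (forall s t : R, 0 <= s -> s < t -> l s < l t) /\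
  l @` [set t | 0 <= t] = [set t | 0 <= t].

(** The sets [skorokhod_ball x T e], for [T] large and [e] small, form a
    neighbourhood base at [x] of the Skorokhod J1 topology on [D(R_+, E)]:
    see Ethier and Kurtz, Markov Processes, Proposition 3.5.3 (c). *)
Definition skorokhod_ball (x : skorokhod) (T e : R) : set skorokhod :=
  [set y | exists2 l, time_change l & forall t : R, 0 <= t <= T ->
     `|l t - t| < e /\ ball (x (l t)) e (y t)].

Definition skorokhod_open (O : set skorokhod) : Prop :=
  forall x, O x -> exists T e, 0 < e /\ skorokhod_ball x T e `<=` O.

Lemma skorokhod_ballS x (T T' e e' : R) : T' <= T -> e <= e' ->
  skorokhod_ball x T e `<=` skorokhod_ball x T' e'.
Proof.
move=> TT ee y [l ltc yl]; exists l => // t /andP[t0 tT].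
have [|lt xy] := yl t; first by rewrite t0 (le_trans tT).
by split; [exact: lt_le_trans ee|exact: le_ball xy].
Qed.

Lemma skorokhod_openT : skorokhod_open setT.
Proof. by move=> x _; exists 0, 1. Qed.

Lemma skorokhod_openI : setI_closed skorokhod_open.
Proof.
move=> A B oA oB x [/oA[T [e [e0 TA]]] /oB[S [d [d0 SB]]]].
exists (Num.max T S), (Num.min e d); rewrite lt_min e0 d0; split=> // y yTS.
by split; [apply: TA|apply: SB]; apply: skorokhod_ballS yTS;
  rewrite ?ge_min ?le_max lexx ?orbT.
Qed.

Lemma skorokhod_open_bigU (I : Type) (O : I -> set skorokhod) :
  (forall i, skorokhod_open (O i)) -> skorokhod_open (\bigcup_i O i).
Proof.
move=> oO x [i _ /oO[T [e [e0 TO]]]]; exists T, e; split=> // y /TO Oy.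
by exists i.
Qed.

HB.instance Definition _ := isOpenTopological.Build skorokhod
  skorokhod_openT skorokhod_openI skorokhod_open_bigU.

Definition canonical_filtration (t : R) : set (set skorokhod) :=
  <<s \bigcup_(s in `[0, t])
        preimage_set_system setT (fun x : skorokhod => x s : borel E) measurable >>.

Definition canonical_sigma : set (set skorokhod) :=
  <<s \bigcup_(t in [set t : R | 0 <= t]) canonical_filtration t >>.

Lemma canonical_sigma0 : canonical_sigma set0.
Proof. exact: sigma_algebra0. Qed.

Lemma canonical_sigmaC A : canonical_sigma A -> canonical_sigma (~` A).
Proof. exact: sigma_algebraC. Qed.

Lemma canonical_sigma_bigcup (A : (set skorokhod)^nat) :
  (forall i, canonical_sigma (A i)) -> canonical_sigma (\bigcup_i A i).
Proof. exact: sigma_algebra_bigcup. Qed.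

Definition skorokhod_display : measure_display.
Proof. by constructor. Qed.

HB.instance Definition _ := @isMeasurable.Build skorokhod_display skorokhod
  canonical_sigma canonical_sigma0 canonical_sigmaC canonical_sigma_bigcup.

End cadlag_paths.

Section processes.
Context {R : realType} d (T : measurableType d).
Implicit Type F : R -> set (set T).

Definition filtration F : Prop :=
  [/\ forall t : R, 0 <= t -> sigma_algebra setT (F t),
      forall t : R, 0 <= t -> F t `<=` measurable
    & forall s t : R, 0 <= s -> s <= t -> F s `<=` F t].

Definition measurable_wrt d' (T' : measurableType d') (S : set (set T))
    (f : T -> T') : Prop :=
  preimage_set_system setT f measurable `<=` S.

Definition martingale (P : probability T R) F (M : R -> T -> R) : Prop :=
  [/\ forall t : R, 0 <= t -> measurable_wrt (F t) (M t),
      forall t : R, 0 <= t -> P.-integrable setT (EFin \o M t)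
    & forall (s t : R) A, 0 <= s -> s <= t -> F s A ->
        (\int[P]_(w in A) (M t w)%:E = \int[P]_(w in A) (M s w)%:E)%E].

Definition predictable_sigma F : set (set (R * T)) :=
  <<s [set t : R | 0 <= t] `*` setT,
      [set [set 0 : R] `*` A | A in F 0] `|`
      [set B | exists (s t : R) A, [/\ 0 <= s, s <= t, F s A & B = `]s, t] `*` A]] >>.

Definition predictable F d' (T' : measurableType d') (m : R -> T -> T') : Prop :=
  preimage_set_system ([set t : R | 0 <= t] `*` setT) (fun z => m z.1 z.2)
    measurable `<=` predictable_sigma F.

End processes.

Section controlled_martingale_problem.
Context {R : realType} (E U : polishType R).
Context d (Os : measurableType d) (Ps : probability Os R).
Variable Fs : R -> set (set Os).

Definition Cb (f : E -> R) : Prop := continuous f /\ bounded_on setT f.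

Definition coef : Type := R -> skorokhod E -> U -> E -> R.

Definition admissible_coef (g : coef) : Prop :=
  measurable_fun
    [set z : R * skorokhod E * borel U * borel E | 0 <= z.1.1.1]
    (fun z => g z.1.1.1 z.1.1.2 z.1.2 z.2) /\
  forall (T : R) (x : skorokhod E), 0 <= T ->
    (\int[lebesgue_measure]_(t in `[0%R, T])
       ereal_sup [set `|g t (stopped t x) u (x t)|%:E | u in [set: U]] < +oo)%E.

Definition generator (G : set ((E -> R) * coef)) : Prop :=
  forall f g, G (f, g) -> Cb f /\ admissible_coef g.

(** The sigma-algebra on [pprobability] is generated by the evaluations
    [mu |-> mu B]; as [U] is Polish, it is the Borel sigma-algebra of the weak
    topology. *)
Definition control : Type := R -> Os -> pprobability (borel U) R.

Definition control_process (m : control) : Prop := predictable Fs m.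

(** Convergence of [m1(dt, du) = m1_t(du) dt] as stated with the weight
    [exp(-t)]. *)
Definition control_cvg (m : nat -> control) (m1 : control) (w : Os) : Prop :=
  forall phi : R * U -> R,
    {within [set z | 0 <= z.1], continuous phi} ->
    bounded_on [set z | 0 <= z.1] phi ->
    (\int[lebesgue_measure]_(t in `[0, +oo[)
       (\int[m n t w]_u (phi (t, u) * expR (- t)))) @[n --> \oo] -->
    \int[lebesgue_measure]_(t in `[0, +oo[)
       (\int[m1 t w]_u (phi (t, u) * expR (- t))).

Definition enlarged_filtration (t : R) : set (set (Os * skorokhod E)) :=
  <<s [set A `*` B | A in Fs t & B in canonical_filtration t] >>.

Definition averaged_coef (g : coef) (m : control) (r : R)
    (w : Os * skorokhod E) : R :=
  \int[m r w.1]_u g r (stopped r w.2) u (w.2 r).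

Definition relaxed_rules (G : set ((E -> R) * coef)) (x0 : E) (m : control) :
    set (probability (Os * skorokhod E)%type R) :=
  [set P : probability (Os * skorokhod E)%type R |
   [/\ forall A, measurable A -> P (A `*` setT) = Ps A,
      P [set w : Os * skorokhod E | w.2 0 = x0] = 1%E
    & forall f g, G (f, g) -> martingale P enlarged_filtration
        (fun t w => f (w.2 t) - \int[lebesgue_measure]_(s in `[0, t]) averaged_coef g m s w)]].

Definition stable_test (xi : Os * skorokhod E -> R) : Prop :=
  [/\ measurable_fun setT xi, bounded_on setT xi
    & forall ws, continuous (fun x : skorokhod E => xi (ws, x))].

Definition stable_topology : Type :=
  sup_topology (fun xi : {xi : Os * skorokhod E -> R | stable_test xi} =>
    Topological.class (initial_topology
      (fun P : probability (Os * skorokhod E)%type R => 'E_P[sval xi]%E))).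

HB.instance Definition _ := Topological.on stable_topology.

End controlled_martingale_problem.

(* Main.v *)
Require Import Defs.
From mathcomp Require Import all_boot all_order all_algebra.
From mathcomp Require Import all_classical all_reals all_analysis.
From mathcomp Require Import measurable_realfun ring.

(** The path functionals [x |-> \int_0^t \int_U g m_r(du) dr] are continuous on
    the Skorokhod space, since a Skorokhod-convergent sequence converges, and so
    do the stopped paths, at every continuity time of the limit; but
    [x |-> f (x t)] is not.  Against a test function [phi] that is
    [F_b]-measurable and continuous in the path, the martingale property makes
    [r |-> E_n[f(X_r) phi]], [r >= b], Lipschitz uniformly in [n], while the time
    averages of [f(X_r)] are continuous functionals; hence
    [E_n[f(X_r) phi] --> E_oo[f(X_r) phi]] for every [r >= b].  The martingale
    identity of [P n] therefore passes to the limit for such [phi].  These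
    [phi] generate the sigma-algebra at every time [s < b], by time averages
    again, so a pi-lambda argument and [b] decreasing to [s] conclude. *)

Set Implicit Arguments.
Unset Strict Implicit.
Unset Printing Implicit Defensive.

Import Order.TTheory GRing.Theory Num.Theory.
Import numFieldNormedType.Exports.

Local Open Scope classical_set_scope.
Local Open Scope ring_scope.

(** * Bounded integrands *)

(** Three points shape the argument. A continuous functional that only looks at the path on
    [[0, s]], with [s > 0], cannot see a jump at [s]: delaying the jump slightly erases it from
    [[0, s]] while the path hardly moves in the Skorokhod topology. Continuous tests known at time
    [s] thus do not generate the sigma-algebra at [s] in general, which is why tests are taken at a
    later time [b] and the increment begins at [b] as well. The martingale property is stated on
    events, while stable convergence speaks of functions. The layer-cake formula leads from events
    to bounded functions; the way back approximates the indicator of a set [psi > 0] by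
    [1 - exp (- j psi)]. Finally, the drift of [m n] varies together with the measure [P n]. It is
    split into the drift of [minf], one fixed functional that is continuous in the path, and a
    remainder whose expectation against a test vanishes by the assumed convergence. *)

Section bounded_integrals.
Context d (T : measurableType d) (R : realType).
Variable mu : {measure set T -> \bar R}.

Lemma bounded_integrable (D : set T) (f : T -> R) (C : R) :
  measurable D -> (mu D < +oo)%E -> measurable_fun D f ->
  (forall x, D x -> `|f x| <= C) -> mu.-integrable D (EFin \o f).
Proof.
move=> mD muD mf fC; apply: measurable_bounded_integrable => //.
exists C; split; first exact: num_real.
by move=> M CM x Dx; apply/ltW/(le_lt_trans _ CM)/fC.
Qed.

Lemma normr_Rintegral_bound (D : set T) (f : T -> R) (C : R) :
  measurable D -> (mu D < +oo)%E -> measurable_fun D f ->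
  (forall x, D x -> `|f x| <= C) ->
  `|\int[mu]_(x in D) f x| <= C * fine (mu D).
Proof.
move=> mD muD mf fC.
have fi := bounded_integrable mD muD mf fC.
apply: (le_trans (le_normr_Rintegral mD fi)).
rewrite -Rintegral_cst//; apply: le_Rintegral => //.
  exact: integrable_abse fi.
apply: (@bounded_integrable _ _ `|C|) => //.
Qed.

Lemma bounded_cvg_Rintegral (D : set T) (f_ : nat -> T -> R) (f : T -> R)
    (C : R) :
  measurable D -> (mu D < +oo)%E -> (forall n, measurable_fun D (f_ n)) ->
  measurable_fun D f ->
  (forall n x, D x -> `|f_ n x| <= C) ->
  {ae mu, forall x, D x -> f_ ^~ x @ \oo --> f x} ->
  \int[mu]_(x in D) f_ n x @[n --> \oo] --> \int[mu]_(x in D) f x.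
Proof.
move=> mD muD mf_ mf fC f_f.
have Ci : mu.-integrable D (EFin \o cst C).
  exact: (@bounded_integrable _ _ `|C|).
have [] := @dominated_convergence _ _ _ mu D mD
  (fun n => EFin \o f_ n) (EFin \o f) (EFin \o cst C) _ _ _ Ci _.
- by move=> n; exact/measurable_EFinP.
- exact/measurable_EFinP.
- apply: filterS f_f => x /= f_f Dx; apply: cvg_EFin; first exact: nearW.
  exact: f_f.
- by apply/aeW => x n Dx; rewrite lee_fin; exact: fC.
move=> fi _ cv.
apply: fine_cvg; rewrite fineK//.
exact: integrable_fin_num fi.
Qed.

End bounded_integrals.

Lemma probability_setT_lty d (T : measurableType d) (R : realType)
  (P : probability T R) : (P setT < +oo)%E.
Proof. by rewrite probability_setT ltry. Qed.

Lemma itv_cc_lty (R : realType) (a b : R) :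
  (@lebesgue_measure R `[a, b] < +oo)%E.
Proof. by rewrite /= lebesgue_measure_itv/=; case: ifP => _; rewrite ltry. Qed.

Lemma fine_lebesgue_itv_cc (R : realType) (a b : R) : a <= b ->
  fine (@lebesgue_measure R `[a, b]) = b - a.
Proof.
rewrite /= lebesgue_measure_itv/= lte_fin.
by rewrite le_eqVlt => /predU1P[->|->]//; rewrite ltxx subrr.
Qed.

Section bounded_fubini.
Context d (T : measurableType d) (R : realType).
Variables (P : probability T R) (F : R * T -> R) (C a b : R).
Hypotheses (mF : measurable_fun setT F)
  (FC : forall r w, r \in `[a, b] -> `|F (r, w)| <= C).

Let mFr r : measurable_fun setT (fun w => F (r, w)).
Proof. exact: measurableT_comp mF (measurable_pair1 _). Qed.

Let mFw w : measurable_fun setT (fun r => F (r, w)).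
Proof. exact: measurableT_comp mF (measurable_pair2 _). Qed.

Let muab : (@lebesgue_measure R `[a, b] < +oo)%E.
Proof. exact: itv_cc_lty. Qed.

(** [F] is bounded on the strip [[a, b]] only. Cutting it off there gives a function integrable for
    the product of Lebesgue measure and [P] on the whole space, to which Fubini applies. *)
Let G z := F z * \1_`[a, b] z.1.

Let GE r w : G (r, w) = ((fun r => F (r, w)) \_ `[a, b]) r.
Proof. by rewrite /G patchE indicE; case: ifPn; rewrite ?mulr1 ?mulr0. Qed.

Let intG w : \int[lebesgue_measure]_(r in `[a, b]) F (r, w) =
  fine (fubini_G lebesgue_measure (EFin \o G) w).
Proof.
rewrite Rintegral_mkcond /fubini_G; congr fine.
by apply: eq_integral => r _ /=; rewrite GE.
Qed.

Let iG : (lebesgue_measure \x P)%E.-integrable setT (EFin \o G).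
Proof.
have mG : measurable_fun setT G.
  apply: measurable_funM => //; apply: measurableT_comp => //.
apply/integrable12ltyP; first exact/measurable_EFinP.
apply: (@le_lt_trans _ _
    (\int[lebesgue_measure]_(r in `[a, b]) `|C|%:E)%E); last first.
  by rewrite integral_cst// lte_mul_pinfty.
rewrite [leRHS]integral_mkcond; apply: ge0_le_integral => //.
- by move=> r _; apply: integral_ge0.
- apply: (measurable_fun_fubini_tonelli_F (abse \o (EFin \o G))) => //=.
  by apply: measurableT_comp => //; exact/measurable_EFinP.
- apply/(measurable_restrictT _ _).1 => //; exact: measurable_cst.
- move=> r _; rewrite patchE; case: ifPn => rab.
    apply: (@le_trans _ _ (\int[P]_w `|C|%:E)%E).
      apply: ge0_le_integral => //.
        by apply: measurableT_comp => //; apply/measurable_EFinP/measurableT_comp.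
      move=> w _; rewrite lee_fin GE patchE rab (le_trans (FC _ _))//.
        by move: rab; rewrite inE.
      exact: ler_norm.
    by rewrite integral_cst// [X in (_ * X)%E]probability_setT mule1.
  (* Off the strip the restriction returns the default [point], which is [0] in [R]. *)
  by rewrite integral0_eq// => w _; rewrite /= GE patchE (negbTE rab)
    [point]/(0 : R) normr0.
Qed.

Let fin_fubini_G w : fubini_G lebesgue_measure (EFin \o G) w \is a fin_num.
Proof.
rewrite /fubini_G.
rewrite (_ : integral _ _ _ =
    \int[lebesgue_measure]_(r in `[a, b]) (F (r, w))%:E)%E; last first.
  by rewrite [RHS]integral_mkcond; apply: eq_integral => r _;
    rewrite restrict_EFin/= GE.
apply: integrable_fin_num => //.
apply: (@bounded_integrable _ _ _ _ _ _ C) => //.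
  exact: measurable_funTS (mFw w).
by move=> r rab; exact: FC.
Qed.

Lemma measurable_bounded_fubini_G :
  measurable_fun setT (fun w => \int[lebesgue_measure]_(r in `[a, b]) F (r, w)).
Proof.
rewrite (eq_fun intG); apply: measurableT_comp => //.
exact: measurable_fubini_G iG.
Qed.

Lemma measurable_bounded_fubini_F :
  measurable_fun `[a, b] (fun r => \int[P]_w F (r, w)).
Proof.
apply: (eq_measurable_fun (fun r => fine (fubini_F P (EFin \o G) r))).
  move=> r rab; congr fine; apply: eq_integral => w _.
  by rewrite /= GE patchE rab.
apply: measurable_funTS; apply: measurableT_comp => //.
exact: measurable_fubini_F iG.
Qed.

Lemma bounded_fubini :
  \int[P]_w \int[lebesgue_measure]_(r in `[a, b]) F (r, w) =
  \int[lebesgue_measure]_(r in `[a, b]) \int[P]_w F (r, w).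
Proof.
under eq_Rintegral do rewrite intG.
rewrite [RHS]Rintegral_mkcond /Rintegral; congr fine.
transitivity (\int[P]_w \int[lebesgue_measure]_r (EFin \o G) (r, w))%E.
  by apply: eq_integral => w _; rewrite fineK.
rewrite -(Fubini iG); apply: eq_integral => r _.
rewrite patchE; case: ifPn => rab.
  rewrite fineK.
    by apply: eq_integral => w _; rewrite /= GE patchE rab.
  apply: integrable_fin_num => //; apply: (@bounded_integrable _ _ _ _ _ _ C) => //.
    exact: probability_setT_lty.
  by move=> w _; apply: FC; move: rab; rewrite inE.
by rewrite integral0_eq// => w _; rewrite /= GE patchE (negbTE rab).
Qed.

End bounded_fubini.

Lemma measurable_fun_ltr_nat d (T : measurableType d) (R : realType)
    (u v : T -> R) : measurable_fun setT u -> measurable_fun setT v ->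
  measurable_fun setT (fun x => (u x < v x)%R%:R : R).
Proof.
move=> mu mv.
rewrite (_ : (fun _ => _) = \1_[set x | u x < v x]); last first.
  apply/funext => z; rewrite indicE; congr (nat_of_bool _)%:R.
  by apply/idP/idP; rewrite inE.
apply: measurable_indic; rewrite -[X in measurable X]setTI.
exact: measurable_fun_ltr.
Qed.

Lemma Rintegral_itv_bound (R : realType) (h : R -> R) (c B a t : R) :
  a <= t -> measurable_fun `[a, t] h ->
  (forall r, r \in `[a, t] -> `|h r - c| <= B) ->
  `|\int[lebesgue_measure]_(r in `[a, t]) h r - (t - a) * c| <= B * (t - a).
Proof.
move=> at_ mh hB.
have lat := fine_lebesgue_itv_cc at_.
have iat := itv_cc_lty a t.
rewrite -lat mulrC -Rintegral_cst// -RintegralB//.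
- apply: normr_Rintegral_bound => //.
  by apply: measurable_funB => //; exact: measurable_cst.
- have hi := @bounded_integrable _ _ _ (@lebesgue_measure R) `[a, t]%classic h
    (B + `|c|) (measurable_itv _) iat mh.
  refine (hi _) => r rat.
  by rewrite -[h r](subrK c) (le_trans (ler_normD _ _))// lerD2r hB.
- by apply: (@bounded_integrable _ _ _ _ _ _ `|c|) => //; exact: measurable_cst.
Qed.

(** * From events to bounded functions *)

Section expectation_sub_sigma.
Context d (T : measurableType d) (R : realType).

(** The levels [c] in [[-K, K]] below [x] form an interval of length [x + K]. With [x] the value of
    a bounded function, the function becomes a superposition of indicators of its superlevel
    sets. *)
Lemma layer_cake (K x : R) : `|x| <= K ->
  \int[lebesgue_measure]_(c in `[- K, K]) (c < x)%R%:R = x + K.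
Proof.
move=> xK; have [Kx {}xK] : - K <= x /\ x <= K by apply/andP; rewrite -ler_norml.
have -> : x + K = \int[lebesgue_measure]_(c in `[- K, K] `&` [set c : R | c < x]) 1.
  rewrite Rintegral_cst ?mul1r; last first.
    by apply: measurableI => //; rewrite -set_itvNyo; exact: measurable_itv.
  rewrite (_ : _ `&` _ = `[- K, x[%classic); last first.
    apply/seteqP; split=> c /=; rewrite !in_itv/=.
      by move=> [/andP[-> _] ->].
    by move=> /andP[-> cx]; split=> //; rewrite (le_trans (ltW cx)).
  by rewrite /= lebesgue_measure_itv/= lte_fin; case: ltrP => [|xK'] /=;
    rewrite ?opprK//; apply/eqP; rewrite addr_eq0 eq_le Kx xK'.
rewrite Rintegral_mkcondr; apply: eq_Rintegral => c _; rewrite patchE.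
by case: ifPn => [/set_mem/= -> //|]; rewrite notin_setE/= => /negP/negbTE ->.
Qed.

(** By the layer-cake formula and Fubini, the expectation of [Z * (phi + K)] is the integral over
    the levels [c] of the expectations of [Z] on the events [c < phi]. These lie in [S], so the
    integral vanishes; the term in [K] vanishes because [setT] is in [S]. *)
Lemma expectation_sub_sigma (P : probability T R) (S : set (set T))
    (Z phi : T -> R) (C K : R) :
  S setT -> S `<=` measurable -> measurable_fun setT Z ->
  (forall w, `|Z w| <= C) -> measurable_wrt S phi -> (forall w, `|phi w| <= K) ->
  (forall A, S A -> \int[P]_(w in A) Z w = 0) ->
  \int[P]_w (Z w * phi w) = 0.
Proof.
move=> ST Sm mZ ZC mphi phiK ZA.
have mphi' : measurable_fun setT phi.
  by move=> _ B mB; apply/Sm/mphi; exists B.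
pose F (z : R * T) : R := Z z.2 * (z.1 < phi z.2)%R%:R.
have mF : measurable_fun setT F.
  apply: measurable_funM; first exact: measurableT_comp.
  by apply: measurable_fun_ltr_nat => //; exact: measurableT_comp.
have FC r w : r \in `[- K, K] -> `|F (r, w)| <= C.
  move=> _; rewrite /F/= normrM (le_trans _ (ZC w))// ler_piMr//.
  by case: (_ < _); rewrite ?normr1 ?normr0.
have := bounded_fubini P mF FC.
have -> : \int[lebesgue_measure]_(r in `[- K, K]) \int[P]_w F (r, w) = 0.
  under eq_Rintegral => c _.
    rewrite (_ : Rintegral _ _ _ = 0); first over.
    rewrite -(ZA [set w | c < phi w]); last first.
      by apply: mphi; exists `]c, +oo[%classic => //;
        rewrite setTI; apply/seteqP; split=> w /=; rewrite in_itv/= andbT.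
    rewrite [RHS]Rintegral_mkcond; apply: eq_Rintegral => w _.
    rewrite /F patchE; case: ifPn => [/set_mem/= ->|]; first by rewrite mulr1.
    by rewrite notin_setE/= => /negP/negbTE ->; rewrite mulr0.
  by rewrite Rintegral_cst// mul0r.
under eq_Rintegral => w _.
  rewrite /F/= RintegralZl//; last first.
    apply: (@bounded_integrable _ _ _ _ _ _ 1) => //.
    - exact: itv_cc_lty.
    - by apply: measurable_funTS; apply: measurable_fun_ltr_nat.
    - by move=> x _; case: (_ < _); rewrite ?normr1 ?normr0.
  rewrite layer_cake// mulrDr; over.
have PT := probability_setT_lty P.
have iZ : P.-integrable setT (EFin \o Z).
  exact: (bounded_integrable _ _ _ (fun w _ => ZC w)).
rewrite RintegralD//.
- by rewrite RintegralZr// ZA// mul0r addr0.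
- apply: (@bounded_integrable _ _ _ _ _ _ (C * K)) => //.
    exact: measurable_funM.
  by move=> w _; rewrite normrM ler_pM.
- apply: (@bounded_integrable _ _ _ _ _ _ (C * `|K|)) => //.
    exact: measurable_funM.
  by move=> w _; rewrite normrM ler_pM.
Qed.

End expectation_sub_sigma.

(** * Continuity on the Skorokhod space *)

Lemma contract_continuous (R : realType) : continuous (@contract R).
Proof.
move=> x; apply/cvgrPdist_lt => e e0.
exact: (nbhsx_ballx x e e0).
Qed.

(** The function is the distance to the complement of [O]. That distance is infinite when the
    complement is empty; [contract] brings it into the unit interval and keeps its sign. *)
Lemma open_positive_fun (R : realType) (E : pseudoMetricType R) (O : set E) :
  open O -> exists k : E -> R,
    [/\ continuous k, forall x, `|k x| <= 1, forall x, 0 <= k x & O = [set x | 0 < k x]].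
Proof.
move=> oO; pose D := @edist_inf R E (~` O).
have D0 x : (0 <= D x)%E by exact: edist_inf_ge0.
exists (fun x => contract (D x)); split.
- move=> x; apply: continuous_comp; first exact: edist_inf_continuous.
  exact: contract_continuous.
- by move=> x; rewrite contract_le1.
- by move=> x; rewrite -contract0 le_contract.
- apply/seteqP; split=> x /= Ox; rewrite -contract0 lt_contract in Ox *.
    have /nbhs_ballP[e /= e0 eO] : nbhs x O by exact: open_nbhs_nbhs.
    apply: (@lt_le_trans _ _ e%:E); first by rewrite lte_fin.
    apply: le_ereal_inf_tmp => _ [y Oy <-]; rewrite leNgt; apply/negP => /edist_lt_ball.
    by move=> /eO.
  apply: contrapT => Ox'; move: Ox; rewrite /D edist_inf0 ?ltxx//.
Qed.

(** Open sets are positivity sets of bounded continuous functions. Measurability into [E] thereby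
    reduces to the real-valued case, where it is stable under pointwise limits. *)
Lemma measurable_fun_borel (R : realType) (E : pseudoPMetricType R)
    d (T : measurableType d) (f : T -> borel E) :
  (forall k : E -> R, continuous k -> (forall x, `|k x| <= 1) ->
    measurable_fun setT (k \o f)) ->
  measurable_fun setT f.
Proof.
move=> kf; apply: (@measurability _ _ _ (borel E) setT f (@open E) erefl) => _ [B oB <-].
have [k [kc k1 k0 ->]] := open_positive_fun oB.
have := kf k kc k1 measurableT `]0, +oo[%classic (measurable_itv _).
congr (measurable (_ `&` _)); apply/seteqP; split=> x /=; rewrite in_itv/= andbT//.
Qed.

Lemma continuous_borel_measurable (R : realType) (E : pseudoPMetricType R) (k : E -> R) :
  continuous k -> measurable_fun setT (k : borel E -> R).
Proof.
move=> kc; apply: (measurability _ (RGenOInfty.measurableE R)).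
move=> _ [_ [a ->] <-]; rewrite setTI; apply: sub_sigma_algebra.
by move/continuousP : kc; apply; rewrite set_itvoy; exact: open_gt.
Qed.

(** * Discontinuities of right-continuous functions *)

Section right_continuous.
Context (R : realType) (E : pseudoMetricType R) (x : R -> E).
Hypothesis xr : forall t, x s @[s --> t^'+] --> x t.

(** Under right continuity a discontinuity can only come from the left. [jump k] collects the times
    at which the left oscillation does not fall below [1 / (k + 1)]. *)
Let jump (k : nat) : set R :=
  [set t | forall e, 0 < e -> exists2 s, t - e < s < t & ~ ball (x t) k.+1%:R^-1 (x s)].

Let countable_jump k : countable (jump k).
Proof.
(* Just after [t] the values stay within half of [1 / (k + 1)] of [x t], so any two of them are
   close and no time there belongs to [jump k]. A rational chosen in that gap determines [t] among
   the points of [jump k]: two points with the same rational would put the later one in the gap of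
   the earlier one. *)
have /choice[q qP] t : exists q : rat, t < ratr q /\
    forall t', t < t' <= ratr q -> ~ jump k t'.
  have : \forall s \near t^'+, ball (x t) (k.+1%:R^-1 / 2) (x s).
    by move/cvg_ballP : (xr (t := t)); apply; rewrite divr_gt0.
  move=> [e /= e0 eP].
  have [q] := @rat_in_itvoo R t (t + e) ltac:(by rewrite ltrDl).
  rewrite in_itv/= => /andP[tq qe]; exists q; split=> // t' /andP[tt' t'q] jt'.
  have [|s] := jt' (t' - t); rewrite ?subr_gt0// subKr => /andP[st' s't] [].
  have B u : t < u -> u < t + e -> ball (x t) (k.+1%:R^-1 / 2) (x u).
    move=> tu ut; apply: (eP u) => //=.
    by rewrite ltr0_norm ?subr_lt0// opprB ltrBlDl.
  apply: (@ball_splitr _ _ (x t)); apply: B => //.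
    exact: le_lt_trans qe.
  by rewrite (lt_trans s't)// (le_lt_trans t'q).
apply/countable_injP; exists (pickle \o q) => t t'; rewrite !inE => jt jt'.
move=> /(pcan_inj pickleK) qq.
have [tt'|tt'|//] := ltgtP t t'.
- by case: (qP t) => _ /(_ t') []//; rewrite tt' qq ltW//; case: (qP t').
- by case: (qP t') => _ /(_ t) []//; rewrite tt' -qq ltW//; case: (qP t).
Qed.

Lemma countable_right_continuous :
  countable [set t | ~ {for t, continuous x}].
Proof.
apply: (@sub_countable _ _ _ (\bigcup_k jump k)); last first.
  exact: bigcup_countable.
apply: subset_card_le => t; apply: contra_notP => jt.
apply/cvg_ballP => e e0.
have [k ke] : exists k, k.+1%:R^-1 < e.
  exact: filter_ex (near_infty_natSinv_lt (PosNum e0)).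
have : ~ jump k t by move=> jkt; apply: jt; exists k.
move=> /existsNP[e1] /not_implyP[e10 /forall2NP h1].
have [e2 /= e20 h2] : \forall s \near t^'+, ball (x t) e (x s).
  by move/cvg_ballP : (xr (t := t)); apply.
have e120 : 0 < Num.min e1 e2 by rewrite lt_min e10.
apply: filterS (nbhsx_ballx t _ e120) => s tse.
have /andP[s1 s2] : (`|t - s| < e1) && (`|t - s| < e2) by rewrite -lt_min.
have [st|ts|->] := ltgtP s t; last exact: ballxx.
- apply: (@le_ball _ _ (x t) _ _ (ltW ke)).
  have [/negP|/contrapT//] := h1 s; rewrite st andbT -leNgt => ste.
  exfalso; move: s1; apply/negP; rewrite -leNgt gtr0_norm ?subr_gt0//.
  by rewrite lerBrDl addrC -lerBrDl.
- exact: h2.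
Qed.

End right_continuous.

Section skorokhod_continuity.
Context {R : realType} (E : polishType R).
Implicit Types x : skorokhod E.

Lemma path_right_continuous x t : x s @[s --> t^'+] --> x t.
Proof.
have [xneg xr _] := path_cadlag x.
have [t0|t0] := leP 0 t; first exact: xr.
by apply: cvg_near_cst; apply: filterS (nbhs_right_lt t0) => s s0; rewrite !xneg.
Qed.

(* Openness at [x] only has to be tested on the balls of radius [1 / (n + 1)],
   so that sequences suffice. *)
Lemma skorokhod_sequential_continuous (T : topologicalType)
    (F : skorokhod E -> T) :
  (forall x (y : nat -> skorokhod E),
    (forall n, skorokhod_ball x n%:R n.+1%:R^-1 (y n)) ->
    F (y n) @[n --> \oo] --> F x) ->
  continuous F.
Proof.
move=> Fy; apply/continuousP => A oA; suff : skorokhod_open (F @^-1` A) by [].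
move=> x Ax; apply: contrapT => noball.
have /choice[y yP] n : exists y, skorokhod_ball x n%:R n.+1%:R^-1 y /\ ~ A (F y).
  apply: contrapT => ney; apply: noball; exists n%:R, n.+1%:R^-1; split=> // y xy.
  by apply: contrapT => nAy; apply: ney; exists y.
have /Fy Fyx : forall n, skorokhod_ball x n%:R n.+1%:R^-1 (y n).
  by move=> n; case: (yP n).
have : nbhs (F x) A by exact: open_nbhs_nbhs.
move=> /Fyx[N _ /(_ N (leqnn _))]/=.
by case: (yP N).
Qed.

Section along_sequence.
Variables (x : skorokhod E) (y : nat -> skorokhod E).
Hypothesis xy : forall n, skorokhod_ball x n%:R n.+1%:R^-1 (y n).

Variable r : R.
Hypotheses (r0 : 0 <= r) (xc : {for r, continuous x}).

Lemma eval_cvg : y n r @[n --> \oo] --> x r.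
Proof.
apply/cvg_ballP => e e0.
have e20 : 0 < e / 2 by rewrite divr_gt0.
have [d /= d0 dP] : \forall v \near r, ball (x r) (e / 2) (x v).
  by move/cvg_ballP : xc; exact.
near=> n.
have [l lt lP] := xy n.
have [|lr xyr] := lP r; first by rewrite r0/=; near: n; exact: nbhs_infty_ger.
apply: (@ball_split _ _ (x (l r))).
  apply: (dP (l r)); rewrite /= distrC (lt_trans lr)//.
  by near: n; exact: (near_infty_natSinv_lt (PosNum d0)).
apply: le_ball xyr; apply/ltW.
by near: n; exact: (near_infty_natSinv_lt (PosNum e20)).
Unshelve. all: by end_near. Qed.

(** The time change [l] that brings [y n] close to [x] also serves the stopped paths. The two
    stoppings disagree only when [r] separates [t] from [l t]; then [l t] is close to [r], and
    continuity of [x] at [r] replaces [x (l t)] by [x r]. After [r], the values [x r], [x (l r)] and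
    [y n r] are compared in turn, which accounts for the thirds of [e]. *)
Lemma stopped_cvg : stopped r (y n) @[n --> \oo] --> stopped r x.
Proof.
move=> A; rewrite nbhsE => -[B [oB Bx] BA]; apply: filterS BA _.
have [T [e [e0 TB]]] := oB _ Bx.
suff : \forall n \near \oo, skorokhod_ball (stopped r x) T e (stopped r (y n)).
  by apply: filterS => n; exact: TB.
have e30 : 0 < e / 3 by rewrite divr_gt0.
have [d /= d0 dP] : \forall v \near r, ball (x r) (e / 3) (x v).
  by move/cvg_ballP : xc; exact.
have [d' /= [d'0 d'd]] : exists d', 0 < d' /\ d' <= Num.min d (e / 3).
  by exists (Num.min d (e / 3)); rewrite lt_min d0 e30.
near=> n.
have nd : n.+1%:R^-1 < d'.
  by near: n; exact: (near_infty_natSinv_lt (PosNum d'0)).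
have nr : r <= n%:R by near: n; exact: nbhs_infty_ger.
have nT : T <= n%:R by near: n; exact: nbhs_infty_ger.
have ne : n.+1%:R^-1 <= e / 3.
  by rewrite (le_trans (ltW nd))// (le_trans d'd)// ge_min lexx orbT.
have {}nd : n.+1%:R^-1 <= d by rewrite (le_trans (ltW nd))// (le_trans d'd)// ge_min lexx.
have [l lt lP] := xy n.
have xd v : `|r - v| < d -> ball (x r) (e / 3) (x v) by move=> rv; exact: (dP v).
have e3E : e = e / 3 + e / 3 + e / 3 by field.
have le3 : e / 3 + e / 3 <= e by rewrite [leRHS]e3E lerDl ltW.
exists l => // t /andP[t0 tT].
have [|lt1 xyt] := lP t; first by rewrite t0 (le_trans tT).
split; first by rewrite (lt_le_trans lt1)// (le_trans ne)// (le_trans _ le3)// lerDl ltW.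
have [|lr1 xyr] := lP r; first by rewrite r0.
rewrite /=; have [tr|rt] := leP t r.
  have [lr|rl] := leP (l t) r.
    by apply: le_ball xyt; rewrite (le_trans ne)// (le_trans _ le3)// lerDl ltW.
  apply: (le_ball le3); apply: ball_triangle (le_ball ne xyt).
  apply: xd; rewrite distrC gtr0_norm ?subr_gt0//.
  rewrite (le_lt_trans _ (lt_le_trans lt1 nd))// (le_trans _ (ler_norm _))//.
  by rewrite lerD2l lerN2.
rewrite [X in ball _ X]e3E; apply: ball_triangle (le_ball ne xyr).
apply: (@ball_triangle _ _ (x r)); last first.
  by apply: xd; rewrite distrC (lt_le_trans lr1).
apply: ball_sym; apply: xd.
have [lr|rl] := leP r (l t); first by rewrite subrr normr0.
rewrite gtr0_norm ?subr_gt0// (le_lt_trans _ (lt_le_trans lt1 nd))//.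
by rewrite distrC (le_trans _ (ler_norm _))// lerD2r ltW.
Unshelve. all: by end_near. Qed.

End along_sequence.

(** The constant extension to negative times makes [0] a continuity time of every path, so
    evaluation at [0] is a continuous functional. This carries the initial condition to the
    limit. *)
Lemma continuous0 x : {for 0, continuous x}.
Proof.
apply/cvg_ballP => e e0.
have [d /= d0 dP] : \forall s \near 0^'+, ball (x 0) e (x s).
  by move/cvg_ballP : (@path_right_continuous x 0); exact.
apply: filterS (nbhsx_ballx (0 : R) _ d0) => s s0.
have [xneg _ _] := path_cadlag x.
have [sn|sp|->] := ltgtP s 0; last exact: ballxx.
  by rewrite xneg//; exact: ballxx.
exact: dP.
Qed.

End skorokhod_continuity.

(** * Measurability and continuity of integrals along paths *)

Lemma ae_path_continuous (R : realType) (E : polishType R) (x : skorokhod E) :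
  {ae lebesgue_measure, forall r, {for r, continuous x}}.
Proof.
have cD := countable_right_continuous (@path_right_continuous _ _ x).
exists [set t | ~ {for t, continuous x}]; split => //.
  by apply: countable_measurable => // t; exact: measurable_set1.
exact: countable_lebesgue_measure0.
Qed.

(** * Progressive measurability and occupation integrals *)

Section progressive.
Context {R : realType} (E : polishType R) d (T : measurableType d).
Variables (X : T -> skorokhod E) (t : R).
Hypotheses (t0 : 0 <= t)
  (mX : forall r : R, 0 <= r <= t -> measurable_fun setT (fun w => X w r : borel E)).

Let mX' (r : R) : r <= t -> measurable_fun setT (fun w => X w r : borel E).
Proof.
move=> rt; have [r0|r0] := leP 0 r; first by apply: mX; rewrite r0.
rewrite (_ : (fun _ => _) = fun w => X w 0 : borel E); first by apply: mX; rewrite lexx.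
by apply/funext => w; have [-> ] := path_cadlag (X w).
Qed.

(* Right continuity makes [X] the limit of its values at the times
   [(floor (s * (n + 1)) + 1) / (n + 1) > s]. *)
Lemma progressive_measurable :
  measurable_fun setT (fun z : R * T => X z.2 (Num.min t z.1) : borel E).
Proof.
apply: measurable_fun_borel => k kc k1.
pose q n (s : R) : R := (Num.floor (s * n.+1%:R) + 1)%:~R / n.+1%:R.
pose h n (z : R * T) := k (X z.2 (Num.min t (q n z.1))).
have qgt n s : s < q n s by rewrite /q ltr_pdivlMr// floorD1_gt.
have qle n s : q n s <= s + n.+1%:R^-1.
  by rewrite /q intrD mulrDl mul1r lerD2r ler_pdivrMr// ge_floor.
apply: (measurable_fun_cvg (h := h)) => [n|[s w] _].
  move=> _ B mB; rewrite setTI.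
  rewrite (_ : _ @^-1` _ = \bigcup_(j : int)
     ([set s | Num.floor (s * n.+1%:R) = j] `*`
      [set w | B (k (X w (Num.min t ((j + 1)%:~R / n.+1%:R))))])); last first.
    apply/seteqP; split=> [[s w] /= Bs|[s w] [j _ [/= <- //]]].
    by exists (Num.floor (s * n.+1%:R)).
  apply: countable_bigcupT_measurable => // j; apply: measurableX.
    rewrite (_ : mkset _ = `[j%:~R / n.+1%:R, (j + 1)%:~R / n.+1%:R[%classic).
      exact: measurable_itv.
    apply/seteqP; split=> s /=; rewrite in_itv/= ler_pdivrMr// ltr_pdivlMr//.
      by move=> <-; rewrite ge_floor floorD1_gt.
    by move=> sj; apply: floor_def.
  have mk := continuous_borel_measurable kc.
  have mXj := mX' (r := Num.min t ((j + 1)%:~R / n.+1%:R)) ltac:(by rewrite ge_min lexx).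
  by have := measurableT_comp mk mXj measurableT mB; rewrite setTI.
rewrite /h /=.
(* The stopped path is again a path, so its right continuity treats the times before and after [t]
   alike. *)
have : k (stopped t (X w) u) @[u --> s^'+] --> k (stopped t (X w) s).
  by apply: continuous_cvg; [exact: kc|exact: path_right_continuous].
move/cvg_at_rightP => /(_ (q ^~ s)); apply; split=> //.
apply: (@squeeze_cvgr _ _ _ _ (cst s) (fun n => s + n.+1%:R^-1)).
- by apply: nearW => n; rewrite ltW//= qle.
- exact: cvg_cst.
- rewrite -[X in _ --> X]addr0; apply: cvgD; first exact: cvg_cst.
  exact: cvg_harmonic.
Qed.

Section occupation.
Variables (k : E -> R) (C a : R).
Hypotheses (kc : continuous k) (kC : forall e, `|k e| <= C).

Let F (z : R * T) := k (X z.2 (Num.min t z.1)).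

Let mF : measurable_fun setT F.
Proof.
have mk := continuous_borel_measurable kc.
exact: (measurableT_comp mk progressive_measurable).
Qed.

Let FE r w : r \in `[a, t] -> F (r, w) = k (X w r).
Proof. by rewrite in_itv/= => /andP[_ rt]; rewrite /F/= min_r. Qed.

Lemma measurable_path_comp w : measurable_fun `[a, t] (fun r => k (X w r)).
Proof.
apply: (eq_measurable_fun (fun r => F (r, w))).
  by move=> r; rewrite inE/= => rat; rewrite FE.
apply: measurable_funTS; exact: measurable_fun_pair1.
Qed.

Lemma measurable_occupation :
  measurable_fun setT (fun w => \int[lebesgue_measure]_(r in `[a, t]) k (X w r)).
Proof.
rewrite (_ : (fun _ => _) = fun w => \int[lebesgue_measure]_(r in `[a, t]) F (r, w)).
  (* Only measurability in [w] is at stake, so any probability will do in the Fubini argument; a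
     Dirac mass is at hand. *)
  exact: (measurable_bounded_fubini_G (dirac point) mF (fun _ _ _ => kC _)).
by apply/funext => w; apply: eq_Rintegral => r; rewrite inE => rat; rewrite FE.
Qed.

Lemma occupation_fubini (P : probability T R) (phi : T -> R) (K : R) :
  measurable_fun setT phi -> (forall w, `|phi w| <= K) ->
  \int[P]_w ((\int[lebesgue_measure]_(r in `[a, t]) k (X w r)) * phi w) =
  \int[lebesgue_measure]_(r in `[a, t]) \int[P]_w (k (X w r) * phi w).
Proof.
move=> mphi phiK; pose G (z : R * T) := F z * phi z.2.
have mG : measurable_fun setT G.
  by apply: measurable_funM => //; exact: measurableT_comp.
have GC r w : `|G (r, w)| <= C * K by rewrite normrM ler_pM ?kC ?phiK.
rewrite [RHS](_ : _ = \int[lebesgue_measure]_(r in `[a, t]) \int[P]_w G (r, w)).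
  rewrite -(bounded_fubini P mG (fun _ _ _ => GC _ _)).
  apply: eq_Rintegral => w _; rewrite -RintegralZr//.
    by apply: eq_Rintegral => r; rewrite inE => rat; rewrite /G FE.
  apply: (@bounded_integrable _ _ _ _ _ _ C) => //; first exact: itv_cc_lty.
  exact: measurable_path_comp.
apply: eq_Rintegral => r; rewrite inE => rat.
by apply: eq_Rintegral => w _; rewrite /G FE.
Qed.

Lemma occupation_bound (P : probability T R) (phi : T -> R) (K B : R) :
  a <= t -> measurable_fun setT phi -> (forall w, `|phi w| <= K) ->
  (forall r, r \in `[a, t] -> `|\int[P]_w (k (X w r) * phi w) -
                               \int[P]_w (k (X w a) * phi w)| <= B) ->
  `|\int[P]_w ((\int[lebesgue_measure]_(r in `[a, t]) k (X w r)) * phi w) -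
    (t - a) * \int[P]_w (k (X w a) * phi w)| <= B * (t - a).
Proof.
move=> at_ mphi phiK cB; rewrite (occupation_fubini _ mphi phiK).
pose c r := \int[P]_w (k (X w r) * phi w).
have mc : measurable_fun `[a, t] c.
  apply: (eq_measurable_fun (fun r => \int[P]_w (F (r, w) * phi w))).
    by move=> r; rewrite inE => rat; apply: eq_Rintegral => w _; rewrite FE.
  apply: (measurable_bounded_fubini_F P (F := fun z => F z * phi z.2) (C := C * K)).
    by apply: measurable_funM => //; exact: measurableT_comp.
  by move=> r w _; rewrite normrM ler_pM ?kC ?phiK.
exact: Rintegral_itv_bound.
Qed.

End occupation.

(** Good-sets principle with complements relative to a base set [D] that [f] never leaves. The
    predictable sigma-algebra, whose base set is the product of a half-line and the sample space,
    calls for this generality. *)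
Lemma preimage_g_sigma_algebra (T' : Type) (D : set T') (f : T -> T') (G : set (set T')) :
  (forall w, D (f w)) -> (forall B, G B -> measurable (f @^-1` B)) ->
  forall B, <<s D, G >> B -> measurable (f @^-1` B).
Proof.
move=> Df mG; apply: smallest_sub => //; split.
- by rewrite preimage_set0.
- move=> A mA; rewrite (_ : _ @^-1` _ = ~` (f @^-1` A)); first exact: measurableC.
  by apply/seteqP; split=> w /= => [[]|] //.
- by move=> A mA; rewrite preimage_bigcup; exact: bigcupT_measurable.
Qed.

Lemma measurable_fun_skorokhod (Y : T -> skorokhod E) :
  (forall r : R, 0 <= r -> measurable_fun setT (fun w => Y w r : borel E)) ->
  measurable_fun setT Y.
Proof.
move=> mY _ B mB; rewrite setTI; move: B mB.
apply: preimage_g_sigma_algebra => // A [s /= s0].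
move: A; apply: preimage_g_sigma_algebra => // A [r /=].
rewrite in_itv/= => /andP[r0 _] [B mB <-]; rewrite setTI.
by have := mY r r0 measurableT B mB; rewrite setTI.
Qed.

End progressive.

Lemma stopped_min (R : realType) (E : polishType R) (x : skorokhod E) (s t r : R) :
  stopped (Num.min t s) x r = x (Num.min t (Num.min s r)).
Proof. by rewrite /= minA. Qed.

Lemma admissible_coef_comp (R : realType) (E U : polishType R) (g : coef E U)
    d (T : measurableType d) (a : T -> R) (x : T -> skorokhod E) (u : T -> borel U)
    (e : T -> borel E) :
  admissible_coef g -> (forall w, 0 <= a w) ->
  measurable_fun setT a -> measurable_fun setT x -> measurable_fun setT u ->
  measurable_fun setT e -> measurable_fun setT (fun w => g (a w) (x w) (u w) (e w)).
Proof.
move=> [mg _] a0 ma mx mu me.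
pose G w : R * skorokhod E * borel U * borel E := (a w, x w, u w, e w).
have h := measurable_comp (E := setT) (g := G) _ _ mg; apply: h.
- rewrite -[X in measurable X]setTI.
  rewrite (_ : [set z | _] =
      (fun z : R * skorokhod E * borel U * borel E => z.1.1.1) @^-1` `[0, +oo[); last first.
    by apply/seteqP; split=> z /=; rewrite in_itv/= andbT.
  suff mfst : measurable_fun setT
    (fun z : R * skorokhod E * borel U * borel E => z.1.1.1) by exact: mfst.
  by do 2 apply: measurableT_comp => //.
- by move=> _ [z _ <-] /=.
- by do 3 apply: measurable_fun_pair => //.
Qed.

Lemma measurable_coef_control (R : realType) (E U : polishType R) (g : coef E U)
    (t : R) (x : skorokhod E) (e : E) :
  admissible_coef g -> 0 <= t -> measurable_fun setT (fun u : borel U => g t x u e).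
Proof.
move=> mg t0; exact: (admissible_coef_comp (x := cst x) (a := cst t) (e := cst e) mg
  (fun=> t0) (measurable_cst _) (measurable_cst _) (@measurable_id _ _ setT)
  (measurable_cst _)).
Qed.

(** * Measurability of the averaged coefficient and of the drift *)

Section averaged_measurable.
Context {R : realType} (E U : polishType R) d (Os : measurableType d).
Variables (Fs : R -> set (set Os)) (hFs : filtration Fs).
Context d' (T : measurableType d') (p : T -> Os) (X : T -> skorokhod E).
Variables (t : R) (t0 : 0 <= t).
Hypotheses (mp : forall A, Fs t A -> measurable (p @^-1` A))
  (mX : forall r : R, 0 <= r <= t -> measurable_fun setT (fun w => X w r : borel E)).
Variables (m : control U Os) (hm : control_process Fs m).
Variables (g : coef E U) (C : R).
Hypotheses (mg : admissible_coef g)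
  (gC : forall (s : R) x u e, 0 <= s -> `|g s x u e| <= C).

(** Clamping the time to [[0, t]] gives functions on all of [R * T] that involve the control and the
    path up to time [t] only. *)
Let c (s : R) : R := Num.min t (Num.max 0 s).

Let c0 s : 0 <= c s.
Proof. by rewrite /c le_min t0 le_max lexx. Qed.

Let ct s : c s <= t.
Proof. by rewrite /c ge_min lexx. Qed.

Let cE s : 0 <= s <= t -> c s = s.
Proof. by move=> /andP[s0 st]; rewrite /c max_r// min_r. Qed.

Let mc : measurable_fun setT c.
Proof.
by apply: measurable_minr => //; apply: measurable_maxr.
Qed.

Let mXc : measurable_fun setT (fun z : R * T => X z.2 (c z.1) : borel E).
Proof.
apply: (measurableT_comp (progressive_measurable t0 mX)
  (g := fun z : R * T => (Num.max 0 z.1, z.2))).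
apply: measurable_fun_pair => //.
by apply: measurable_maxr => //; exact: measurableT_comp.
Qed.

Let mstopped : measurable_fun setT (fun z : R * T => stopped (c z.1) (X z.2)).
Proof.
apply: measurable_fun_skorokhod => r r0.
rewrite (_ : (fun _ => _) = (fun z : R * T =>
   X z.2 (Num.min t (Num.min (Num.max 0 z.1) r)) : borel E)); last first.
  by apply/funext => z; rewrite stopped_min.
apply: (measurableT_comp (progressive_measurable t0 mX)
  (g := fun z : R * T => (Num.min (Num.max 0 z.1) r, z.2))).
apply: measurable_fun_pair => //.
apply: measurable_minr => //; apply: measurable_maxr => //; exact: measurableT_comp.
Qed.

(** It suffices to pull back the generators of the predictable sigma-algebra. A rectangle over []a,
    b]] with [a < t] has its event in [Fs a], hence in [Fs t]; one with [t <= a] has an empty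
    preimage, because the clamped time never exceeds [t]. *)
Let mcontrol :
  measurable_fun setT (fun z : R * T => m (c z.1) (p z.2)).
Proof.
have [sF Fm FF] := hFs.
move=> _ B mB; rewrite setTI.
pose f (z : R * T) := (c z.1, p z.2).
have : predictable_sigma Fs (([set t : R | 0 <= t] `*` setT) `&`
    (fun z : R * Os => m z.1 z.2) @^-1` B) by apply: hm; exists B.
move=> /(@preimage_g_sigma_algebra _ _ _ _ f) mf.
rewrite (_ : _ @^-1` B = f @^-1` (([set t : R | 0 <= t] `*` setT) `&`
    (fun z : R * Os => m z.1 z.2) @^-1` B)); last first.
  by apply/seteqP; split=> z /= => [|[]].
apply: mf => [z|]; first by split => //=.
have rect (S : set R) A : measurable S -> Fs t A -> measurable (f @^-1` (S `*` A)).
  move=> mS FA; rewrite (_ : _ @^-1` _ = (c @^-1` S) `*` (p @^-1` A))//.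
  by apply: measurableX; [rewrite -[X in measurable X]setTI; exact: mc|exact: mp].
move=> _ [[A FA <-]|[a [b [A [a0 ab FA ->]]]]].
  by apply: rect => //; apply: FF FA.
have [at_|ta] := leP a t.
  apply: rect; [exact: measurable_itv|exact: FF FA].
rewrite (_ : _ @^-1` _ = set0)//; apply/seteqP; split=> // z [/=].
by rewrite in_itv/= => /andP[/lt_le_trans/(_ (ct _))]; rewrite ltNge (ltW ta).
Qed.

Lemma measurable_averaged_coef : measurable_fun setT
  (fun z : R * T => averaged_coef g m (c z.1) (p z.2, X z.2)).
Proof.
(* Measurability of kernel integrals is available for nonnegative integrands. Adding the bound [C]
   makes the integrand nonnegative, and since the kernel has mass one, [C] is subtracted again
   afterwards. *)
pose k (zu : R * T * borel U) : \bar R :=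
  (g (c zu.1.1) (stopped (c zu.1.1) (X zu.1.2)) zu.2 (X zu.1.2 (c zu.1.1)) + C)%:E.
have mk : measurable_fun setT k.
  apply/measurable_EFinP; apply: measurable_funD => //.
  apply: admissible_coef_comp => //; last exact: measurableT_comp mXc _.
  - by apply: measurableT_comp mc _; exact: measurableT_comp.
  - exact: measurableT_comp mstopped _.
have gu z u : `|g (c z.1) (stopped (c z.1) (X z.2)) u (X z.2 (c z.1))| <= C by exact: gC.
have k0 z : (0 <= k z)%E.
  rewrite lee_fin -lerBlDr sub0r.
  by have := gu z.1 z.2; rewrite ler_norml => /andP[].
have mint := measurable_fun_integral_finite_kernel k (kprobability mcontrol) k0 mk.
rewrite (_ : (fun _ => _) = (fun z =>
    fine (\int[kprobability mcontrol z]_u k (z, u))%E - C)); last first.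
  apply/funext => z; rewrite /averaged_coef.
  have PT := probability_setT_lty (m (c z.1) (p z.2)).
  have mgz := measurable_coef_control (stopped (c z.1) (X z.2)) (X z.2 (c z.1)) mg (c0 z.1).
  have := RintegralD (mu := m (c z.1) (p z.2)) measurableT
    (bounded_integrable measurableT PT mgz (fun u _ => gu z u))
    (bounded_integrable (C := `|C|) (f := cst C) measurableT PT
      (measurable_cst _) (fun u _ => lexx _)).
  rewrite Rintegral_cst// [X in C * fine X]probability_setT mulr1 => /eqP.
  by rewrite -subr_eq => /eqP <-.
by apply: measurable_funB => //; exact: measurableT_comp mint.
Qed.

Lemma normr_averaged_coef s w : 0 <= s -> `|averaged_coef g m s w| <= C.
Proof.
move=> s0; rewrite /averaged_coef.
have := normr_Rintegral_bound measurableT (probability_setT_lty (m s w.1))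
  (measurable_coef_control (stopped s w.2) (w.2 s) mg s0) (fun u _ => gC _ u _ s0).
by rewrite [X in C * fine X]probability_setT mulr1.
Qed.

Lemma measurable_drift : measurable_fun setT (fun w =>
  \int[lebesgue_measure]_(s in `[0, t]) averaged_coef g m s (p w, X w)).
Proof.
rewrite (_ : (fun _ => _) = fun w => \int[lebesgue_measure]_(s in `[0, t])
    averaged_coef g m (c s) (p w, X w)); last first.
  apply/funext => w; apply: eq_Rintegral => s; rewrite inE/= in_itv/= => /cE.
  by move=> ->.
exact: (measurable_bounded_fubini_G (dirac point) measurable_averaged_coef
  (fun s w _ => normr_averaged_coef _ (c0 s))).
Qed.

Lemma measurable_averaged_path w : measurable_fun `[0, t]
  (fun s => averaged_coef g m s (p w, X w)).
Proof.
apply: (eq_measurable_fun (fun s => averaged_coef g m (c s) (p w, X w))).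
  by move=> s; rewrite inE/= in_itv/= => /cE ->.
apply: measurable_funTS.
exact: (measurable_fun_pair1 w measurable_averaged_coef).
Qed.

End averaged_measurable.

Section evaluation.
Context {R : realType} {E : polishType R}.

Lemma canonical_evaluation (r t : R) (B : set (borel E)) : 0 <= r <= t -> measurable B ->
  canonical_filtration t ((fun x : skorokhod E => x r) @^-1` B).
Proof.
move=> rt mB; apply: sub_sigma_algebra; exists r; first by rewrite /= in_itv.
by exists B => //; rewrite setTI.
Qed.

Lemma canonical_filtration_sub (t : R) : 0 <= t ->
  canonical_filtration t `<=` (measurable : set (set (skorokhod E))).
Proof. by move=> t0 A At; apply: sub_sigma_algebra; exists t. Qed.

Lemma measurable_evaluation (r : R) : 0 <= r ->
  measurable_fun setT (fun x : skorokhod E => x r : borel E).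
Proof.
move=> r0 _ B mB; rewrite setTI; apply: (canonical_filtration_sub r0).
by apply: canonical_evaluation => //; rewrite r0 lexx.
Qed.

Lemma continuous_occupation (k : E -> R) (C a b : R) :
  continuous k -> (forall e, `|k e| <= C) -> 0 <= a -> a <= b ->
  continuous (fun x : skorokhod E => \int[lebesgue_measure]_(r in `[a, b]) k (x r)).
Proof.
move=> kc kC a0 ab; apply: skorokhod_sequential_continuous => x y xy.
have mk (x' : skorokhod E) : measurable_fun `[a, b] (fun r => k (x' r)).
  apply: (@measurable_path_comp _ _ _ _ id b (le_trans a0 ab) _ k a kc x')
    => r /andP[r0 _].
  exact: measurable_evaluation.
apply: (bounded_cvg_Rintegral (C := C)) => //; first exact: itv_cc_lty.
- by move=> n; exact: mk.
- exact: mk.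
apply: (@filterS _ _ (ae_filter_ringOfSetsType (@lebesgue_measure R)) _ _ _
  (ae_path_continuous x)) => r xc rab.
apply: continuous_cvg; first exact: kc.
apply: eval_cvg xc => //.
by move: rab; rewrite /= in_itv/= => /andP[/(le_trans a0)].
Qed.

End evaluation.

Section drift_continuity.
Context {R : realType} (E U : polishType R) d (Os : measurableType d).
Variables (Fs : R -> set (set Os)) (hFs : filtration Fs).
Variables (m : control U Os) (hm : control_process Fs m).
Variables (g : coef E U) (C : R).
Hypotheses (mg : admissible_coef g)
  (gC : forall (s : R) x u e, 0 <= s -> `|g s x u e| <= C)
  (gc : forall (t : R) u, 0 <= t ->
    continuous (fun z : skorokhod E * E => g t z.1 u z.2)).

(** Dominated convergence acts twice: outside in [r], almost every value of which is a continuity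
    time of [x], and inside in [u] with [r] fixed. The inner one asks for convergence at each [u]
    separately, which is what the continuity of [g] for fixed time and control provides. *)
Lemma continuous_drift (t : R) (ws : Os) : 0 <= t -> continuous (fun x : skorokhod E =>
  \int[lebesgue_measure]_(s in `[0, t]) averaged_coef g m s (ws, x)).
Proof.
move=> t0; apply: skorokhod_sequential_continuous => x y xy.
have [sF Fm FF] := hFs.
have ma x' : measurable_fun `[0, t] (fun r => averaged_coef g m r (ws, x')).
  apply: (@measurable_averaged_path _ _ _ _ _ _ hFs _ _ fst snd t t0 _ _ _ hm _ _
    mg gC (ws, x')).
    move=> A FA; rewrite -[X in measurable X]setTI; apply: measurable_fst => //.
    exact: Fm FA.
  move=> r /andP[r0 _]; apply: measurableT_comp (measurable_evaluation r0) _.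
  exact: measurable_snd.
apply: (bounded_cvg_Rintegral (C := C)) => //.
- exact: itv_cc_lty.
- by move=> n; exact: ma.
- exact: ma.
- by move=> n r; rewrite /= in_itv/= => /andP[r0 _]; exact: normr_averaged_coef.
apply: (@filterS _ _ (ae_filter_ringOfSetsType (@lebesgue_measure R)) _ _ _
  (ae_path_continuous x)) => r xc; rewrite /= in_itv/= => /andP[r0 rt].
have gcv (u : U) :
    g r (stopped r (y n)) u (y n r) @[n --> \oo] --> g r (stopped r x) u (x r).
  have yx : (stopped r (y n), y n r) @[n --> \oo] --> (stopped r x, x r).
    have h1 := stopped_cvg xy r0 xc.
    have h2 := eval_cvg xy r0 xc.
    exact: (cvg_pair h1 h2).
  have gcx := @gc r u r0 (stopped r x, x r).
  exact: (cvg_comp (fun n => (stopped r (y n), y n r))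
    (fun z : skorokhod E * E => g r z.1 u z.2) yx gcx).
have h := @bounded_cvg_Rintegral _ _ _ (m r ws) setT
  (fun n u => g r (stopped r (y n)) u (y n r)) (fun u => g r (stopped r x) u (x r)) C
  measurableT (probability_setT_lty _) (fun n => measurable_coef_control _ _ mg r0)
  (measurable_coef_control _ _ mg r0) (fun n u _ => gC _ _ _ r0).
apply: h.
by apply: aeW => u _; exact: gcv.
Qed.

End drift_continuity.

(** * Passage to the limit against test functions *)

Lemma expectation_Rintegral d (T : measurableType d) (R : realType)
    (P : probability T R) (X : T -> R) (C : R) :
  measurable_fun setT X -> (forall w, `|X w| <= C) ->
  ('E_P[X] = (\int[P]_w X w)%:E)%E.
Proof.
move=> mX XC; rewrite unlock /Rintegral fineK//.
apply: integrable_fin_num => //.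
exact: (bounded_integrable measurableT (probability_setT_lty P) mX (fun w _ => XC w)).
Qed.

Lemma stable_cvg_Rintegral (R : realType) (E : polishType R) d (Os : measurableType d)
    (P : nat -> probability (Os * skorokhod E)%type R)
    (Pinf : probability (Os * skorokhod E)%type R) (xi : Os * skorokhod E -> R) :
  (P n : stable_topology E Os) @[n --> \oo] --> (Pinf : stable_topology E Os) ->
  stable_test xi -> \int[P n]_w xi w @[n --> \oo] --> \int[Pinf]_w xi w.
Proof.
move=> Pc xit; have [mxi [C xiC] _] := xit.
have EE (Q : probability (Os * skorokhod E)%type R) : 'E_Q[xi]%E = (\int[Q]_w xi w)%:E.
  by apply: (@expectation_Rintegral _ _ _ _ _ C) => // w; exact: xiC.
suff : 'E_(P n)[xi]%E @[n --> \oo] --> 'E_Pinf[xi]%E.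
  rewrite EE; under eq_fun do rewrite EE.
  by move/fine_cvg.
have /cvg_sup/(_ (exist _ xi xit)) Pxi := Pc.
exact: (cvg_comp _ _ Pxi (@initial_continuous _ _
  (fun Q : probability (Os * skorokhod E)%type R => 'E_Q[xi]%E) Pinf)).
Qed.

(** * The enlarged filtration *)

Section enlarged.
Context {R : realType} {E : polishType R} d {Os : measurableType d}.
Variables (Fs : R -> set (set Os)) (hFs : filtration Fs).

(** With its generator named, [g_sigma_algebraType] turns the product space into a measurable space
    whose events are those of [enlarged_filtration] at [t]. The measurability results above hold
    over an arbitrary source space; applied to this one, they yield adaptedness. *)
Definition filtration_rectangles (t : R) : set (set (Os * skorokhod E)) :=
  [set A `*` B | A in Fs t & B in canonical_filtration t].

Lemma filtrationT t : 0 <= t -> Fs t setT.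
Proof.
by have [sF _ _] := hFs => /sF[F0 FC _]; rewrite -(setD0 setT); exact: FC.
Qed.

Lemma canonical_filtrationT t : canonical_filtration t (setT : set (skorokhod E)).
Proof.
by move=> B [[B0 BC _] _]; rewrite -(setD0 setT); exact: BC.
Qed.

Lemma canonical_filtrationS (s t : R) : s <= t ->
  canonical_filtration s `<=` (canonical_filtration t : set (set (skorokhod E))).
Proof.
move=> st; apply: sub_sigma_algebra2 => A [r /=]; rewrite in_itv/= => /andP[r0 rs] rA.
by exists r => //=; rewrite in_itv/= r0 (le_trans rs).
Qed.

Lemma enlarged_filtration_sub t : 0 <= t ->
  enlarged_filtration Fs t `<=` (measurable : set (set (Os * skorokhod E))).
Proof.
move=> t0; apply: smallest_sub; first exact: sigma_algebra_measurable.
move=> _ [A FA [B FB <-]]; apply: measurableX.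
  by have [_ Fm _] := hFs; exact: Fm FA.
exact: canonical_filtration_sub FB.
Qed.

Lemma enlarged_filtrationS (s t : R) : 0 <= s -> s <= t ->
  enlarged_filtration Fs s `<=` (enlarged_filtration Fs t : set (set (Os * skorokhod E))).
Proof.
move=> s0 st; apply: sub_sigma_algebra2 => _ [A FA [B FB <-]].
have [_ _ FF] := hFs.
by exists A; [exact: FF FA|exists B => //; exact: canonical_filtrationS FB].
Qed.

Lemma enlarged_filtrationT t : enlarged_filtration Fs t (setT : set (Os * skorokhod E)).
Proof.
by move=> B [[B0 BC _] _]; rewrite -(setD0 setT); exact: BC.
Qed.

Lemma enlarged_fst t A : 0 <= t -> Fs t A ->
  enlarged_filtration Fs t ((fst : Os * skorokhod E -> Os) @^-1` A).
Proof.
move=> t0 FA; apply: sub_sigma_algebra; exists A => //.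
by exists setT; [exact: canonical_filtrationT|apply/seteqP; split=> w /= // []].
Qed.

Lemma enlarged_snd t B : 0 <= t -> canonical_filtration t B ->
  enlarged_filtration Fs t ((snd : Os * skorokhod E -> skorokhod E) @^-1` B).
Proof.
move=> t0 FB; apply: sub_sigma_algebra; exists setT; first exact: filtrationT.
by exists B => //; apply/seteqP; split=> w /= // [].
Qed.

End enlarged.

Section limit.
Context {R : realType} {E U : polishType R} d {Os : measurableType d}.
Variables (Fs : R -> set (set Os)) (hFs : filtration Fs).
Variables (f : E -> R) (g : coef E U) (Cf Cg : R).
Hypotheses (fc : continuous f) (fC : forall e, `|f e| <= Cf)
  (mg : admissible_coef g)
  (gC : forall (s : R) x u e, 0 <= s -> `|g s x u e| <= Cg)
  (gc : forall (t : R) u, 0 <= t ->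
    continuous (fun z : skorokhod E * E => g t z.1 u z.2)).

Local Notation Om := (Os * skorokhod E)%type.
Local Notation Ft t := (g_sigma_algebraType (@filtration_rectangles _ E _ _ Fs t)).

Definition drift (m : control U Os) (t : R) (w : Om) : R :=
  \int[lebesgue_measure]_(s in `[0, t]) averaged_coef g m s w.

Definition compensated (m : control U Os) (t : R) (w : Om) : R :=
  f (w.2 t) - drift m t w.

Lemma measurable_evaluation_enlarged (t r : R) : 0 <= r <= t ->
  measurable_fun setT (fun w : Ft t => w.2 r : borel E).
Proof.
move=> rt _ B mB; rewrite setTI.
apply: (enlarged_snd hFs) (canonical_evaluation rt mB).
by have /andP[r0] := rt; exact: le_trans.
Qed.

Section control.
Variables (m : control U Os) (hm : control_process Fs m).

Lemma measurable_averaged_itv (t : R) (w : Om) : 0 <= t ->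
  measurable_fun `[0, t] (fun s => averaged_coef g m s (w : Om)).
Proof.
move=> t0.
have := @measurable_averaged_path _ _ _ _ _ _ hFs _ (Ft t) fst snd t t0 _ _ _ hm _ _
  mg gC w.
rewrite -surjective_pairing; apply.
- by move=> A FA; apply: (enlarged_fst t0).
- by move=> r rt; exact: measurable_evaluation_enlarged.
Qed.

Lemma integrable_averaged (t : R) (w : Om) : 0 <= t ->
  lebesgue_measure.-integrable `[0, t] (EFin \o (fun s => averaged_coef g m s (w : Om))).
Proof.
move=> t0.
have h := @bounded_integrable _ _ _ (@lebesgue_measure R) `[0, t]%classic
  (fun s => averaged_coef g m s w) Cg (measurable_itv _) (itv_cc_lty 0 t)
  (measurable_averaged_itv w t0).
refine (h _) => s; rewrite /= in_itv/= => /andP[s0 _].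
exact: normr_averaged_coef.
Qed.

Lemma measurable_drift_enlarged (t : R) : 0 <= t ->
  measurable_fun setT (drift m t : Ft t -> R).
Proof.
move=> t0.
rewrite (_ : drift m t = fun w => \int[lebesgue_measure]_(s in `[0, t])
    averaged_coef g m s (w.1, w.2)); last by apply/funext => -[].
have := @measurable_drift _ _ _ _ _ _ hFs _ (Ft t) fst snd t t0 _ _ _ hm _ _ mg gC.
apply.
- by move=> A FA; apply: (enlarged_fst t0).
- by move=> r rt; exact: measurable_evaluation_enlarged.
Qed.

Lemma drift_itv (s t : R) (w : Om) : 0 <= s -> s <= t ->
  \int[lebesgue_measure]_(r in `[s, t]) averaged_coef g m r w = drift m t w - drift m s w.
Proof.
move=> s0 st.
have i0t := integrable_averaged w (le_trans s0 st).
rewrite -Rintegral_itv_obnd_cbnd; last first.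
  apply: integrableS i0t => //; apply: subset_itvr; rewrite bnd_simp//.
by rewrite /drift (Rintegral_itvB i0t) ?bnd_simp.
Qed.

Lemma normr_drift_itv (s t : R) (w : Om) : 0 <= s -> s <= t ->
  `|drift m t w - drift m s w| <= Cg * (t - s).
Proof.
move=> s0 st; rewrite -(drift_itv w s0 st).
rewrite -(fine_lebesgue_itv_cc st); apply: normr_Rintegral_bound => //.
  exact: itv_cc_lty.
  apply: measurable_funS (measurable_averaged_itv w (le_trans s0 st)) => //.
  by apply: subset_itvr; rewrite bnd_simp.
move=> r; rewrite /= in_itv/= => /andP[sr _].
by apply: normr_averaged_coef => //; exact: le_trans sr.
Qed.

Lemma normr_drift (t : R) (w : Om) : 0 <= t -> `|drift m t w| <= Cg * t.
Proof.
move=> t0; have := normr_drift_itv w (lexx 0) t0.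
rewrite {2}/drift set_itv1 Rintegral_set1 !subr0; exact.
Qed.

Lemma right_continuous_compensated (s : R) (w : Om) : 0 <= s ->
  compensated m r w @[r --> s^'+] --> compensated m s w.
Proof.
move=> s0; have fs : f (w.2 r) @[r --> s^'+] --> f (w.2 s).
  by apply: continuous_cvg; [exact: fc|exact: path_right_continuous].
apply: (cvgB fs); apply/cvgrPdist_le => e e0.
have Cg0 : 0 <= Cg by rewrite (le_trans _ (gC point point point (lexx 0))).
(* The Lipschitz constant [Cg] of the drift may be zero, so the radius is obtained by dividing by
   [Cg + 1]. *)
have Cg1 : 0 < Cg + 1 by rewrite ltr_wpDl.
near=> r.
have sr : s < r by near: r; exact: nbhs_right_gt.
have re : r < s + e / (Cg + 1).
  by near: r; apply: nbhs_right_lt; rewrite ltrDl divr_gt0.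
rewrite distrC (le_trans (normr_drift_itv w s0 (ltW sr)))//.
have rse : r - s <= e / (Cg + 1) by rewrite lerBlDl ltW.
rewrite (le_trans (ler_wpM2l Cg0 rse))// mulrCA ler_piMr// ?(ltW e0)//.
by rewrite ler_pdivrMr// mul1r lerDl.
Unshelve. all: by end_near. Qed.

Lemma measurable_compensated_enlarged (t : R) : 0 <= t ->
  measurable_fun setT (compensated m t : Ft t -> R).
Proof.
move=> t0; apply: measurable_funB; last exact: measurable_drift_enlarged.
apply: (measurableT_comp (continuous_borel_measurable fc)).
by apply: measurable_evaluation_enlarged; rewrite t0 lexx.
Qed.

Lemma normr_compensated (t : R) (w : Om) : 0 <= t ->
  `|compensated m t w| <= Cf + Cg * t.
Proof.
by move=> t0; rewrite (le_trans (ler_normB _ _))// lerD// normr_drift.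
Qed.

End control.
Lemma drift_itvB (m m' : control U Os) (s t : R) (w : Om) :
  control_process Fs m -> control_process Fs m' -> 0 <= s -> s <= t ->
  \int[lebesgue_measure]_(r in `[s, t]) (averaged_coef g m r w - averaged_coef g m' r w) =
  (drift m t w - drift m s w) - (drift m' t w - drift m' s w).
Proof.
move=> hm hm' s0 st; rewrite -!drift_itv//.
have sub : `[s, t] `<=` `[0, t] by apply: subset_itvr; rewrite bnd_simp.
have i0t m0 (hm0 : control_process Fs m0) :
    lebesgue_measure.-integrable `[s, t] (EFin \o (fun r => averaged_coef g m0 r w)).
  have h := integrable_averaged hm0 w (le_trans s0 st).
  by apply: integrableS h.
exact: (@RintegralB _ _ _ (@lebesgue_measure R) `[s, t]%classic _ _
  (measurable_itv _) (i0t _ hm) (i0t _ hm')).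
Qed.

Lemma measurable_of_enlarged (t : R) (h : Om -> R) : 0 <= t ->
  measurable_fun setT (h : Ft t -> R) -> measurable_fun setT h.
Proof.
move=> t0 mh _ B mB; rewrite setTI; apply: (enlarged_filtration_sub hFs t0).
by have := mh measurableT B mB; rewrite setTI.
Qed.

Lemma measurable_wrt_enlarged (t : R) (h : Om -> R) :
  measurable_fun setT (h : Ft t -> R) <-> measurable_wrt (enlarged_filtration Fs t) h.
Proof.
split=> [mh _ [B mB <-]|mh _ B mB]; first exact: mh.
by apply: mh; exists B.
Qed.

Lemma measurable_fpath (r : R) : 0 <= r ->
  measurable_fun setT (fun w : Om => f (w.2 r)).
Proof.
move=> r0; apply: (measurable_of_enlarged r0).
apply: (measurableT_comp (continuous_borel_measurable fc)).
by apply: measurable_evaluation_enlarged; rewrite r0 lexx.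
Qed.

Section martingale_increments.
Variables (m : control U Os) (hm : control_process Fs m) (P : probability Om R).

Let mM (t : R) : 0 <= t -> measurable_fun setT (compensated m t).
Proof.
by move=> t0; apply: (measurable_of_enlarged t0); exact: measurable_compensated_enlarged.
Qed.

Let iM (t : R) (A : set Om) : 0 <= t -> measurable A ->
  P.-integrable A (EFin \o compensated m t).
Proof.
move=> t0 mA; apply: (integrableS measurableT mA) => //.
exact: (bounded_integrable measurableT (probability_setT_lty P) (mM t0)
  (fun w _ => normr_compensated hm w t0)).
Qed.

Lemma martingale_increment (s t : R) (A : set Om) : 0 <= s -> s <= t -> measurable A ->
  ((\int[P]_(w in A) (compensated m t w)%:E = \int[P]_(w in A) (compensated m s w)%:E)%E
   <-> \int[P]_(w in A) (compensated m t w - compensated m s w) = 0).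
Proof.
move=> s0 st mA; have t0 := le_trans s0 st.
have it := iM t0 mA; have iMs := iM s0 mA.
have -> : \int[P]_(w in A) (compensated m t w - compensated m s w) =
    \int[P]_(w in A) compensated m t w - \int[P]_(w in A) compensated m s w.
  exact: (RintegralB mA it iMs).
split=> [|/eqP]; first by rewrite /Rintegral => ->; rewrite subrr.
rewrite subr_eq0 => /eqP MM.
have e1 : (\int[P]_(w in A) (compensated m t w)%:E)%E =
    (\int[P]_(w in A) compensated m t w)%:E.
  have ft := integrable_fin_num mA it.
  exact (esym (fineK ft)).
have e2 : (\int[P]_(w in A) (compensated m s w)%:E)%E =
    (\int[P]_(w in A) compensated m s w)%:E.
  have fs := integrable_fin_num mA iMs.
  exact (esym (fineK fs)).
by rewrite e1 e2; exact (congr1 EFin MM).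
Qed.

Lemma martingale_test (s t : R) (phi : Om -> R) (K : R) :
  martingale P (enlarged_filtration Fs) (compensated m) ->
  0 <= s -> s <= t ->
  measurable_wrt (enlarged_filtration Fs s) phi -> (forall w, `|phi w| <= K) ->
  \int[P]_w ((compensated m t w - compensated m s w) * phi w) = 0.
Proof.
move=> [_ _ Mst] s0 st mphi phiK; have t0 := le_trans s0 st.
have Fm : enlarged_filtration Fs s `<=` (measurable : set (set Om)).
  exact: enlarged_filtration_sub.
pose Z w := compensated m t w - compensated m s w.
have mZ : measurable_fun setT Z by apply: measurable_funB; exact: mM.
have ZC w : `|Z w| <= (Cf + Cg * t) + (Cf + Cg * s).
  by rewrite (le_trans (ler_normB _ _))// lerD// normr_compensated.
have ST : enlarged_filtration Fs s (setT : set Om) by exact: enlarged_filtrationT.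
have h := @expectation_sub_sigma _ _ _ P _ Z phi _ K ST Fm mZ ZC mphi phiK; apply: h.
by move=> A FA; apply/(martingale_increment s0 st (Fm _ FA)); exact: Mst.
Qed.

End martingale_increments.

Lemma stable_testM (xi zeta : Om -> R) :
  stable_test xi -> stable_test zeta -> stable_test (fun w => xi w * zeta w).
Proof.
move=> [mxi [C xiC] cxi] [mzeta [K zetaK] czeta]; split.
- exact: measurable_funM.
- by exists (C * K) => w _; rewrite normrM ler_pM// ?xiC ?zetaK.
- by move=> ws x; apply: continuousM; [exact: cxi|exact: czeta].
Qed.

Lemma stable_test_drift (m : control U Os) (t : R) :
  control_process Fs m -> 0 <= t -> stable_test (drift m t).
Proof.
move=> hm t0; split.
- by apply: (measurable_of_enlarged t0); exact: measurable_drift_enlarged.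
- by exists (Cg * t) => w _; exact: normr_drift.
- by move=> ws; exact: (continuous_drift hFs hm mg gC gc).
Qed.

Lemma stable_test_occupation (a b : R) : 0 <= a -> a <= b ->
  stable_test (fun w : Om => \int[lebesgue_measure]_(r in `[a, b]) f (w.2 r)).
Proof.
move=> a0 ab; have b0 := le_trans a0 ab; split.
- apply: (@measurable_occupation _ _ _ Om snd b b0 _ _ Cf _ fc fC) => r /andP[r0 _].
  by apply: measurableT_comp (measurable_evaluation r0) _; exact: measurable_snd.
- exists (Cf * fine (@lebesgue_measure R `[a, b])) => w _.
  apply: normr_Rintegral_bound => //; first exact: itv_cc_lty.
  apply: (@measurable_path_comp _ _ _ _ id b b0 _ f a fc w.2) => r /andP[r0 _].
  exact: measurable_evaluation.
- by move=> ws; exact: (continuous_occupation fc fC).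
Qed.

Definition bounded_measurable (h : Om -> R) :=
  measurable_fun setT h /\ exists C, forall w, `|h w| <= C.

Lemma bounded_measurableM h k : bounded_measurable h -> bounded_measurable k ->
  bounded_measurable (fun w => h w * k w).
Proof.
move=> [mh [C hC]] [mk [K kK]]; split; first exact: measurable_funM.
by exists (C * K) => w; rewrite normrM ler_pM.
Qed.

Lemma bounded_measurableB h k : bounded_measurable h -> bounded_measurable k ->
  bounded_measurable (fun w => h w - k w).
Proof.
move=> [mh [C hC]] [mk [K kK]]; split; first exact: measurable_funB.
by exists (C + K) => w; rewrite (le_trans (ler_normB _ _))// lerD.
Qed.

Lemma bounded_measurable_integrable (Q : probability Om R) h :
  bounded_measurable h -> Q.-integrable setT (EFin \o h).
Proof.
move=> [mh [C hC]].
exact: (bounded_integrable measurableT (probability_setT_lty Q) mh (fun w _ => hC w)).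
Qed.

Lemma bounded_RintegralB (Q : probability Om R) h k :
  bounded_measurable h -> bounded_measurable k ->
  \int[Q]_w (h w - k w) = \int[Q]_w h w - \int[Q]_w k w.
Proof.
move=> bh bk; exact: (RintegralB measurableT
  (bounded_measurable_integrable Q bh) (bounded_measurable_integrable Q bk)).
Qed.

Lemma normr_expectation (Q : probability Om R) (h : Om -> R) (C : R) :
  measurable_fun setT h -> (forall w, `|h w| <= C) -> `|\int[Q]_w h w| <= C.
Proof.
move=> mh hC.
have := normr_Rintegral_bound measurableT (probability_setT_lty Q) mh (fun w _ => hC w).
by rewrite [X in C * fine X]probability_setT mulr1.
Qed.

Lemma bounded_measurable_fpath (r : R) : 0 <= r ->
  bounded_measurable (fun w => f (w.2 r)).
Proof. by move=> r0; split; [exact: measurable_fpath|exists Cf]. Qed.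

Lemma bounded_measurable_stable xi : stable_test xi -> bounded_measurable xi.
Proof. by move=> [mxi [C xiC] _]; split=> //; exists C => w; exact: xiC. Qed.

Lemma bounded_measurable_drift m (r : R) : control_process Fs m -> 0 <= r ->
  bounded_measurable (drift m r).
Proof.
by move=> hm r0; apply: bounded_measurable_stable; exact: stable_test_drift.
Qed.

Section test_function.
Variables (b K : R) (phi : Om -> R).
Hypotheses (b0 : 0 <= b) (phi_stable : stable_test phi)
  (mphi : measurable_wrt (enlarged_filtration Fs b) phi)
  (phiK : forall w, `|phi w| <= K).

Let bphi := bounded_measurable_stable phi_stable.

Let c (Q : probability Om R) (r : R) := \int[Q]_w (f (w.2 r) * phi w).

(** This form of the martingale identity isolates the path term, which is not continuous in the
    path, from the drift term, which is continuous and Lipschitz in time. *)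
Lemma martingale_test_path m (Q : probability Om R) (a r : R) :
  control_process Fs m ->
  martingale Q (enlarged_filtration Fs) (compensated m) -> b <= a -> a <= r ->
  c Q r - c Q a = \int[Q]_w ((drift m r w - drift m a w) * phi w).
Proof.
move=> hm MQ ba ar; have a0 := le_trans b0 ba; have r0 := le_trans a0 ar.
have mphia : measurable_wrt (enlarged_filtration Fs a) phi.
  by apply: subset_trans mphi _; exact: enlarged_filtrationS.
have bfr := bounded_measurable_fpath r0.
have bfa := bounded_measurable_fpath a0.
have bd : bounded_measurable (fun w => drift m r w - drift m a w).
  by apply: bounded_measurableB; exact: bounded_measurable_drift.
have := martingale_test hm MQ a0 ar mphia phiK.
have -> : \int[Q]_w ((compensated m r w - compensated m a w) * phi w) =
    \int[Q]_w ((f (w.2 r) * phi w - f (w.2 a) * phi w) -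
               (drift m r w - drift m a w) * phi w).
  by apply: eq_Rintegral => w _; rewrite /compensated; ring.
rewrite bounded_RintegralB; last 2 first.
- by apply: bounded_measurableB; exact: bounded_measurableM.
- exact: bounded_measurableM.
rewrite bounded_RintegralB; [|exact: bounded_measurableM..].
by move=> /eqP; rewrite subr_eq0 => /eqP.
Qed.

Lemma lipschitz_test_path m (Q : probability Om R) (a r : R) :
  control_process Fs m ->
  martingale Q (enlarged_filtration Fs) (compensated m) -> b <= a -> a <= r ->
  `|c Q r - c Q a| <= Cg * (r - a) * K.
Proof.
move=> hm MQ ba ar; have a0 := le_trans b0 ba; have r0 := le_trans a0 ar.
rewrite (martingale_test_path hm MQ ba ar).
have bd : bounded_measurable (fun w => drift m r w - drift m a w).
  by apply: bounded_measurableB; exact: bounded_measurable_drift.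
apply: normr_expectation => [|w]; first by case: (bounded_measurableM bd bphi).
by rewrite normrM ler_pM// normr_drift_itv.
Qed.

(** The Lipschitz bound rests on the martingale property, which is still to be proved for the limit
    measure. Right continuity, from the paths by dominated convergence, replaces it there: a single
    measure requires no uniformity. *)
Lemma right_continuous_test_path (Q : probability Om R) (a : R) : 0 <= a ->
  c Q r @[r --> a^'+] --> c Q a.
Proof.
move=> a0; apply/cvg_at_rightP => u [au ua].
have bf r (r0 : 0 <= r) := bounded_measurableM (bounded_measurable_fpath r0) bphi.
have h := @bounded_cvg_Rintegral _ _ _ Q setT (fun n w => f (w.2 (u n)) * phi w)
  (fun w => f (w.2 a) * phi w) (Cf * K) measurableT (probability_setT_lty Q).
apply: h.
- by move=> n; apply: (bf _ _).1; rewrite (le_trans a0)// ltW.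
- exact: (bf _ a0).1.
- by move=> n w _; rewrite normrM ler_pM.
apply: aeW => w _; apply: cvgMl.
have : f (w.2 r) @[r --> a^'+] --> f (w.2 a).
  by apply: continuous_cvg; [exact: fc|exact: path_right_continuous].
by move/cvg_at_rightP; exact.
Qed.

Lemma occupation_test_path (Q : probability Om R) (a e B : R) : 0 <= a -> 0 <= e ->
  (forall r, r \in `[a, a + e] -> `|c Q r - c Q a| <= B) ->
  `|\int[Q]_w ((\int[lebesgue_measure]_(r in `[a, a + e]) f (w.2 r)) * phi w) -
    e * c Q a| <= B * e.
Proof.
move=> a0 e0 cB; have ae0 : 0 <= a + e by rewrite addr_ge0.
have ms r : 0 <= r <= a + e -> measurable_fun setT (fun w : Om => w.2 r : borel E).
  move=> /andP[r0 _]; apply: measurableT_comp (measurable_evaluation r0) _.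
  exact: measurable_snd.
have aae : a <= a + e by rewrite lerDl.
have := @occupation_bound _ _ _ Om snd (a + e) ae0 ms f Cf a fc fC Q phi K B aae
  bphi.1 phiK cB.
by rewrite addrAC subrr add0r.
Qed.

Variables (m : nat -> control U Os) (minf : control U Os).
Hypotheses (hm : forall n, control_process Fs (m n)) (hminf : control_process Fs minf).
Variables (P : nat -> probability Om R) (Pinf : probability Om R).
Hypotheses
  (P_martingale : forall n, martingale (P n) (enlarged_filtration Fs) (compensated (m n)))
  (P_cvg : (P n : stable_topology E Os) @[n --> \oo] --> (Pinf : stable_topology E Os)).

(* The path functional [f (X_a)] is not continuous.  Its time averages are, and
   they approximate it uniformly in [n], because [r |-> c (P n) r] is Lipschitz
   with a constant that does not depend on [n]. *)
Lemma cvg_test_path (a : R) : b <= a -> c (P n) a @[n --> \oo] --> c Pinf a.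
Proof.
move=> ba; have a0 := le_trans b0 ba.
have K0 : 0 <= K by rewrite (le_trans _ (phiK point)).
have Cg0 : 0 <= Cg by rewrite (le_trans _ (gC point point point (lexx 0))).
apply/cvgrPdist_le => e e0; have e30 : 0 < e / 3 by rewrite divr_gt0.
have [d1 /= d10 d1P] : \forall r \near a^'+, `|c Pinf a - c Pinf r| <= e / 3.
  by move: (@right_continuous_test_path Pinf _ a0) => /cvgrPdist_le; exact.
(* Length of the averaging window. The first bound keeps the oscillation under [Pinf] below [e / 3];
   the second does so for every [P n], whose Lipschitz constant is [Cg * K], with [+ 1] guarding
   against a zero denominator. *)
pose D := Num.min (d1 / 2) (e / 3 / (Cg * K + 1)).
have CK0 : 0 < Cg * K + 1 by rewrite ltr_wpDl// mulr_ge0.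
have D0 : 0 < D by rewrite lt_min !divr_gt0.
have aD : a <= a + D by rewrite lerDl ltW.
have st := stable_testM (stable_test_occupation a0 aD) phi_stable.
pose J (Q : probability Om R) := \int[Q]_w
  ((\int[lebesgue_measure]_(r in `[a, a + D]) f (w.2 r)) * phi w).
have JPn : J (P n) @[n --> \oo] --> J Pinf := stable_cvg_Rintegral P_cvg st.
have De30 : 0 < D * (e / 3) by rewrite mulr_gt0.
have Jn n : `|J (P n) - D * c (P n) a| <= e / 3 * D.
  apply: occupation_test_path => //; first exact: ltW.
  move=> r; rewrite in_itv/= => /andP[ar rD].
  rewrite (le_trans (lipschitz_test_path (@hm n) (P_martingale n) ba ar))//.
  have h1 : Cg * K * (r - a) <= Cg * K * D by rewrite ler_wpM2l ?mulr_ge0// lerBlDl.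
  have h2 : Cg * K * D <= (Cg * K + 1) * D by rewrite ler_wpM2r ?(ltW D0)// lerDl.
  rewrite mulrAC (le_trans h1)// (le_trans h2)// mulrC -ler_pdivlMr//.
  by rewrite ge_min lexx orbT.
have Jinf : `|J Pinf - D * c Pinf a| <= e / 3 * D.
  apply: occupation_test_path => //; first exact: ltW.
  move=> r; rewrite in_itv/= => /andP[ar rD].
  move: ar; rewrite le_eqVlt => /predU1P[<-|ar]; first by rewrite subrr normr0 ltW.
  rewrite distrC; apply: d1P => //=.
  rewrite ltr0_norm ?subr_lt0// opprB ltrBlDl (le_lt_trans rD)// ltrD2l.
  by rewrite /D gt_min ltr_pdivrMr// ltr_pMr// ltr1n.
move/cvgrPdist_le : JPn => /(_ _ De30); apply: filterS => n JJ.
(* The occupation integrals are not normalised, so the whole estimate is scaled by [D]: one third of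
   [D * e] comes from the convergence of [J], and one from each of the two averaging errors. *)
have key : D * `|c Pinf a - c (P n) a| <= D * e.
  rewrite -[X in X * _]gtr0_norm// -normrM.
  have -> : D * (c Pinf a - c (P n) a) =
    (J Pinf - J (P n)) - (J Pinf - D * c Pinf a) + (J (P n) - D * c (P n) a) by ring.
  have -> : D * e = D * (e / 3) + e / 3 * D + e / 3 * D by field.
  by rewrite (le_trans (ler_normD _ _))// lerD// (le_trans (ler_normB _ _))// lerD.
by rewrite ler_pM2l in key.
Qed.

Hypothesis drift_cvg : forall s t : R, 0 <= s -> s <= t ->
    forall xi : Om -> R,
      measurable_wrt (enlarged_filtration Fs s) xi -> bounded_on setT xi ->
      'E_(P n)[(fun w =>
        (\int[lebesgue_measure]_(r in `[s, t])
           (averaged_coef g (m n) r w - averaged_coef g minf r w)) * xi w)%R]%E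
        @[n --> \oo] --> 0%E.

(** The path increments under [P n] equal the drift increments of [m n]. The former converge by
    [cvg_test_path]. The latter differ from the drift increments of [minf] by a quantity tending to
    zero by [drift_cvg], and those converge because the drift of [minf] times [phi] is itself a
    stable test. Uniqueness of limits gives the identity. *)
Lemma limit_martingale_test (s t : R) : b <= s -> s <= t ->
  \int[Pinf]_w ((compensated minf t w - compensated minf s w) * phi w) = 0.
Proof.
move=> bs st; have s0 := le_trans b0 bs; have t0 := le_trans s0 st.
have mphis : measurable_wrt (enlarged_filtration Fs s) phi.
  by apply: subset_trans mphi _; exact: enlarged_filtrationS.
have bd m' : control_process Fs m' ->
    bounded_measurable (fun w => drift m' t w - drift m' s w).
  by move=> hm'; apply: bounded_measurableB; exact: bounded_measurable_drift.
have bft := bounded_measurableM (bounded_measurable_fpath t0) bphi.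
have bfs := bounded_measurableM (bounded_measurable_fpath s0) bphi.
have bdphi m' (hm' : control_process Fs m') := bounded_measurableM (bd m' hm') bphi.
pose dc (Q : probability Om R) m' := \int[Q]_w ((drift m' t w - drift m' s w) * phi w).
have mart n : c (P n) t - c (P n) s = dc (P n) (m n).
  exact: martingale_test_path.
have cvc : c (P n) t - c (P n) s @[n --> \oo] --> c Pinf t - c Pinf s.
  by apply: cvgB; apply: cvg_test_path => //; exact: le_trans st.
have cvd : dc (P n) minf @[n --> \oo] --> dc Pinf minf.
  have stt := stable_testM (stable_test_drift hminf t0) phi_stable.
  have sts := stable_testM (stable_test_drift hminf s0) phi_stable.
  have dcE (Q : probability Om R) : dc Q minf =
      \int[Q]_w (drift minf t w * phi w) - \int[Q]_w (drift minf s w * phi w).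
    rewrite /dc -(bounded_RintegralB Q (bounded_measurable_stable stt)
      (bounded_measurable_stable sts)).
    by apply: eq_Rintegral => w _; rewrite mulrBl.
  rewrite dcE; under eq_fun do rewrite dcE.
  by apply: cvgB; exact: stable_cvg_Rintegral.
have cv0 : dc (P n) (m n) - dc (P n) minf @[n --> \oo] --> 0.
  have phib : bounded_on setT phi by exists K.
  have dphi n : 'E_(P n)[(fun w => (\int[lebesgue_measure]_(r in `[s, t])
      (averaged_coef g (m n) r w - averaged_coef g minf r w)) * phi w)%R]%E =
      (dc (P n) (m n) - dc (P n) minf)%:E.
    have bn := bdphi _ (@hm n); have binf := bdphi _ hminf.
    have [mb [C bC]] := bounded_measurableB bn binf.
    rewrite (_ : (fun w => _) = fun w => (drift (m n) t w - drift (m n) s w) * phi w -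
        (drift minf t w - drift minf s w) * phi w); last first.
      by apply/funext => w; rewrite drift_itvB// mulrBl.
    by rewrite (expectation_Rintegral _ mb bC) (bounded_RintegralB _ bn binf).
  have := drift_cvg s0 st mphis phib.
  under eq_fun do rewrite dphi.
  exact: fine_cvg.
have : dc (P n) (m n) @[n --> \oo] --> dc Pinf minf.
  rewrite -[X in _ --> X]add0r.
  rewrite (_ : (fun n => dc (P n) (m n)) =
    fun n => (dc (P n) (m n) - dc (P n) minf) + dc (P n) minf).
    exact: cvgD.
  by apply/funext => n; rewrite subrK.
under eq_fun do rewrite -mart.
move=> /(cvg_unique _ cvc); move=> /(_ (@norm_hausdorff _ _)) cE.
have -> : \int[Pinf]_w ((compensated minf t w - compensated minf s w) * phi w) =
   \int[Pinf]_w ((f (w.2 t) * phi w - f (w.2 s) * phi w) -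
                 (drift minf t w - drift minf s w) * phi w).
  by apply: eq_Rintegral => w _; rewrite /compensated; ring.
rewrite bounded_RintegralB; [|exact: bounded_measurableB|exact: bdphi].
rewrite bounded_RintegralB//.
by apply/eqP; rewrite subr_eq0; apply/eqP.
Qed.

End test_function.

End limit.

(** * From test functions to events *)

Section generating_tests.
Context {R : realType} {E : polishType R} d {Os : measurableType d}.
Variables (Fs : R -> set (set Os)) (hFs : filtration Fs) (b : R) (b0 : 0 <= b).

Local Notation Om := (Os * skorokhod E)%type.
Local Notation Ft t := (g_sigma_algebraType (@filtration_rectangles _ E _ _ Fs t)).
Local Notation Fc t := (g_sigma_algebraType (\bigcup_(s in `[0, t])
  preimage_set_system setT (fun x : skorokhod E => x s : borel E) measurable)).

Definition path_test (psi : skorokhod E -> R) : Prop :=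
  [/\ continuous psi, exists K, forall x, `|psi x| <= K &
      measurable_fun setT (psi : Fc b -> R)].

(** Positivity sets of nonnegative functions suit both needs: a product is positive exactly where
    both factors are, so they form a pi-system, and their indicators are limits of continuous
    functions of [psi]. *)
Definition test_sets : set (set Om) :=
  [set B | exists A psi, [/\ Fs b A, path_test psi, forall x, 0 <= psi x &
     B = A `*` [set x | 0 < psi x]]].

Lemma test_setsI : setI_closed test_sets.
Proof.
move=> _ _ [A [psi [FA [cpsi [K psiK] mpsi] psi0 ->]]]
  [B [chi [FB [cchi [L chiL] mchi] chi0 ->]]].
exists (A `&` B), (fun x => psi x * chi x); split.
- have [sF _ _] := hFs.
  rewrite -(smallest_id (sF _ b0)).
  by apply: (@measurableI _ (g_sigma_algebraType (Fs b))); apply: sub_sigma_algebra.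
- split.
  + by move=> x; apply: continuousM; [exact: cpsi|exact: cchi].
  + by exists (K * L) => x; rewrite normrM ler_pM.
  + exact: measurable_funM.
- by move=> x; rewrite mulr_ge0.
apply/seteqP; split=> -[ws x] /=.
  by move=> [[Aw p0] [Bw c0]]; rewrite mulr_gt0.
move=> [[Aw Bw] pc]; have p0 := psi0 x; have c0 := chi0 x.
split; split=> //.
- by rewrite lt0r p0 andbT; apply: contraTneq pc => ->; rewrite mul0r ltxx.
- by rewrite lt0r c0 andbT; apply: contraTneq pc => ->; rewrite mulr0 ltxx.
Qed.

Lemma test_sets_measurable : test_sets `<=` (measurable : set (set Om)).
Proof.
move=> _ [A [psi [FA [_ _ mpsi] _ ->]]].
have [_ Fm _] := hFs.
apply: measurableX; first exact: Fm FA.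
apply: (canonical_filtration_sub b0).
have := mpsi measurableT `]0, +oo[%classic (measurable_itv _).
rewrite setTI; congr (canonical_filtration b _).
by apply/seteqP; split=> x /=; rewrite in_itv/= andbT.
Qed.

Lemma path_testB psi c : path_test psi -> path_test (fun x => psi x - c).
Proof.
move=> [cpsi [K psiK] mpsi]; split.
- by move=> x; apply: continuousB; [exact: cpsi|exact: cst_continuous].
- by exists (K + `|c|) => x; rewrite (le_trans (ler_normB _ _))// lerD2r.
- by apply: measurable_funB => //; exact: measurable_cst.
Qed.

(** Twice the positive part: it is nonnegative and has the same positivity set as [psi]. Applied to
    [psi - c], it presents every superlevel set of a path test as a positivity set. *)
Lemma path_test_pos psi : path_test psi -> path_test (fun x => psi x + `|psi x|).
Proof.
move=> [cpsi [K psiK] mpsi]; split.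
- move=> x; have cx : psi z @[z --> x] --> psi x by exact: cpsi.
  exact: (cvgD cx (cvg_norm cx)).
- exists (K + K) => x; rewrite (le_trans (ler_normD _ _))// lerD//.
  by rewrite normr_id.
- by apply: measurable_funD => //; exact: measurableT_comp.
Qed.

Lemma path_test1 : path_test (cst 1).
Proof.
split; first exact: cst_continuous.
  by exists 1 => x; rewrite normr1.
exact: measurable_cst.
Qed.

Local Notation Tt := (g_sigma_algebraType test_sets).

Lemma test_set_fst A : Fs b A -> measurable ((fst : Tt -> Os) @^-1` A).
Proof.
move=> FA; apply: sub_sigma_algebra; exists A, (cst 1); split=> //.
  exact: path_test1.
by apply/seteqP; split=> -[ws x] //= [].
Qed.

Lemma test_set_snd psi : path_test psi -> measurable_fun setT (fun w : Tt => psi w.2).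
Proof.
move=> tpsi; apply: (measurability _ (RGenOInfty.measurableE R)).
move=> _ [_ [c ->] <-]; rewrite setTI; apply: sub_sigma_algebra.
exists setT, (fun x => (psi x - c) + `|psi x - c|); split.
- exact: filtrationT.
- exact: (path_test_pos (path_testB c tpsi)).
- by move=> x; rewrite -lerBlDl sub0r ler_normr lexx orbT.
apply/seteqP; split=> -[ws x] /=; rewrite in_itv/= andbT.
  by rewrite -subr_gt0 => pc; split=> //; rewrite addr_gt0// normr_gt0 gt_eqF.
move=> [_]; apply: contraTT; rewrite -!leNgt -subr_le0 => pc.
by rewrite ler0_norm// subrr.
Qed.

Lemma path_test_average (k : E -> R) (C r e : R) :
  continuous k -> (forall x, `|k x| <= C) -> 0 <= r -> 0 < e -> r + e <= b ->
  path_test (fun x => e^-1 * \int[lebesgue_measure]_(v in `[r, r + e]) k (x v)).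
Proof.
move=> kc kC r0 e0 reb; have re0 : 0 <= r + e by rewrite addr_ge0 // ltW.
have rre : r <= r + e by rewrite lerDl ltW.
have mk (x : skorokhod E) : measurable_fun `[r, r + e] (fun v => k (x v)).
  apply: (@measurable_path_comp _ _ _ _ id (r + e) re0 _ k r kc x) => v /andP[v0 _].
  exact: measurable_evaluation.
split.
- move=> x; have cx := continuous_occupation kc kC r0 rre (x := x).
  have c1 : {for x, continuous (fun _ : skorokhod E => e^-1)} by exact: cst_continuous.
  exact: (continuousM c1 cx).
- exists (`|e^-1| * (C * fine (@lebesgue_measure R `[r, r + e]))) => x.
  rewrite normrM ler_pM//; apply: normr_Rintegral_bound => //.
    exact: itv_cc_lty.
  exact: mk.
- apply: measurable_funM; first exact: measurable_cst.
  apply: (@measurable_occupation _ _ _ (Fc b) id (r + e) re0 _ k C r kc kC)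
    => v /andP[v0 vre].
  move=> _ B mB; rewrite setTI; apply: canonical_evaluation => //.
  by rewrite v0 (le_trans vre).
Qed.

Lemma cvg_path_average (k : E -> R) (r : R) (x : skorokhod E) (e : nat -> R) :
  continuous k -> 0 <= r -> (forall n, 0 < e n) -> e n @[n --> \oo] --> 0 ->
  (e n)^-1 * \int[lebesgue_measure]_(v in `[r, r + e n]) k (x v) @[n --> \oo] --> k (x r).
Proof.
move=> kc r0 e0 ecv; apply/cvgrPdist_le => h h0.
have [dl /= dl0 dlP] : \forall v \near r^'+, `|k (x r) - k (x v)| <= h.
  have : k (x v) @[v --> r^'+] --> k (x r).
    by apply: continuous_cvg; [exact: kc|exact: path_right_continuous].
  by move/cvgrPdist_le; exact.
move/cvgrPdist_lt : ecv => /(_ _ dl0); apply: filterS => n.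
rewrite sub0r normrN gtr0_norm// => edl.
have ren : 0 <= r + e n by rewrite addr_ge0 // ltW.
have rren : r <= r + e n by rewrite lerDl ltW.
have mk : measurable_fun `[r, r + e n] (fun v => k (x v)).
  apply: (@measurable_path_comp _ _ _ _ id (r + e n) ren _ k r kc x) => v /andP[v0 _].
  exact: measurable_evaluation.
have hB v : v \in `[r, r + e n] -> `|k (x v) - k (x r)| <= h.
  rewrite in_itv/= => /andP[rv vre]; rewrite distrC.
  move: rv; rewrite le_eqVlt => /predU1P[<-|rv]; first by rewrite subrr normr0 ltW.
  apply: dlP => //=.
  by rewrite ltr0_norm ?subr_lt0// opprB ltrBlDl (le_lt_trans vre)// ltrD2l.
have := Rintegral_itv_bound rren mk hB.
rewrite addrAC subrr add0r => ib.
rewrite -(ler_pM2l (e0 n)) -{1}(gtr0_norm (e0 n)) -normrM mulrBr mulrA divff ?gt_eqF//.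
by rewrite mul1r distrC [leRHS]mulrC.
Qed.

(** By right continuity the evaluation at [r <= s] is a limit of averages over [[r, r + e]]. These
    look ahead of [r] and are known at time [b] once [r + e <= b]; for [r = s] this leaves room only
    if [s < b]. *)
Lemma test_sets_generate (s : R) : 0 <= s -> s < b ->
  enlarged_filtration Fs s `<=` (<<s test_sets >> : set (set Om)).
Proof.
move=> s0 sb; apply: smallest_sub; first exact: smallest_sigma_algebra.
move=> _ [A FA [B FB <-]].
have mA : measurable ((fst : Tt -> Os) @^-1` A).
  by apply: test_set_fst; have [_ _ FF] := hFs; exact: FF s0 (ltW sb) _ FA.
have mev r : 0 <= r <= s -> measurable_fun setT (fun w : Tt => w.2 r : borel E).
  move=> /andP[r0 rs]; apply: measurable_fun_borel => k kc k1.
  (* Positive window lengths tending to zero that never reach beyond [b]; [n = 0] uses all the room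
     available. *)
  pose e n := (b - r) / n.+1%:R.
  have br : 0 < b - r by rewrite subr_gt0 (le_lt_trans rs).
  have e0 n : 0 < e n by rewrite divr_gt0.
  have ecv : e n @[n --> \oo] --> 0.
    rewrite -(mulr0 (b - r)); apply: cvgM; first exact: cvg_cst.
    exact: cvg_harmonic.
  apply: (measurable_fun_cvg (h := fun n (w : Tt) => (e n)^-1 *
     \int[lebesgue_measure]_(v in `[r, r + e n]) k (w.2 v))) => [n|w _]; last first.
    exact: cvg_path_average.
  have reb : r + e n <= b 
    by rewrite -lerBrDl /e ler_pdivrMr// ler_peMr ?ler1n// ltW.
  exact: (test_set_snd (path_test_average kc k1 r0 (e0 n) reb)).
have mB : measurable ((snd : Tt -> skorokhod E) @^-1` B).
  move: B FB; apply: preimage_g_sigma_algebra => // B' [r /=].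
  rewrite in_itv/= => rs [B mB <-]; rewrite setTI.
  by have := mev r rs measurableT B mB; rewrite setTI.
rewrite (_ : A `*` B = (fst : Tt -> Os) @^-1` A `&` (snd : Tt -> skorokhod E) @^-1` B)//.
exact: (@measurableI _ Tt).
Qed.

End generating_tests.

(** * Extension from test functions to the generated sigma-algebra *)

Section null_increment.
Context {R : realType} {E : polishType R} d {Os : measurableType d}.
Variables (Fs : R -> set (set Os)) (hFs : filtration Fs) (b : R) (b0 : 0 <= b).

Local Notation Om := (Os * skorokhod E)%type.
Local Notation Ft t := (g_sigma_algebraType (@filtration_rectangles _ E _ _ Fs t)).

Variables (Q : probability Om R) (Z : Om -> R) (C : R).
Hypotheses (mZ : measurable_fun setT Z) (ZC : forall w, `|Z w| <= C)
  (Zphi : forall (phi : Om -> R) (K : R), stable_test phi ->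
    measurable_wrt (enlarged_filtration Fs b) phi -> (forall w, `|phi w| <= K) ->
    \int[Q]_w (Z w * phi w) = 0).

Let iZ (B : set Om) : measurable B -> Q.-integrable B (EFin \o Z).
Proof.
move=> mB.
have h := bounded_integrable measurableT (probability_setT_lty Q) mZ (fun w _ => ZC w).
exact: (integrableS measurableT mB _ h).
Qed.

(** The functions [1 - exp (- j psi)] are bounded and continuous in the path; they vanish where
    [psi = 0] and tend to one where [psi > 0]. Multiplied by the indicator of [A], they are
    admissible tests converging to the indicator of [B]. *)
Lemma null_test_sets B : test_sets Fs b B -> \int[Q]_(w in B) Z w = 0.
Proof.
move=> [A [psi [FA [cpsi [K psiK] mpsi] psi0 BE]]].
have mB : measurable B.
  by apply: (test_sets_measurable hFs b0); exists A, psi; split=> //;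
    split=> //; exists K.
pose h x := expR (- psi x).
have h01 x : 0 <= h x <= 1.
  by rewrite expR_ge0/= -expR0 ler_expR lerNl oppr0 psi0.
have ch : continuous h.
  move=> x; have cx : psi z @[z --> x] --> psi x by exact: cpsi.
  exact: (cvg_comp _ _ (cvgN cx) (@continuous_expR R _)).
pose phi j (w : Om) : R := \1_A w.1 * (1 - h w.2 ^+ j).
have phi1 j w : `|phi j w| <= 1.
  have /andP[hj0 hj1] : 0 <= h w.2 ^+ j <= 1.
    by have /andP[h0 h1] := h01 w.2; rewrite exprn_ge0//= exprn_ile1.
  rewrite /phi indicE; case: (_ \in _) => /=; rewrite ?mul1r ?mul0r ?normr0//.
  by rewrite ger0_norm ?subr_ge0// lerBlDr lerDl.
have mphi j : measurable_fun setT (phi j : Ft b -> R).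
  have mA : measurable ((fst : Ft b -> Os) @^-1` A) by exact: enlarged_fst.
  have m1 := measurable_indic (R := R) (D := setT) mA.
  have mpsi2 : measurable_fun setT (fun w : Ft b => psi w.2).
    move=> _ Y mY; rewrite setTI.
    have pY : canonical_filtration b (psi @^-1` Y).
      by have := mpsi measurableT Y mY; rewrite setTI.
    exact: (enlarged_snd hFs b0 pY).
  have mh : measurable_fun setT (fun w : Ft b => h w.2).
    exact: (measurableT_comp (@measurable_expR R) (measurable_funN mpsi2)).
  exact: (measurable_funM m1 (measurable_funB (measurable_cst _) (measurable_funX j mh))).
have sphi j : stable_test (phi j).
  split.
  - apply: (measurable_of_enlarged hFs b0 (mphi j)).
  - by exists 1 => w _.
  - move=> ws x.
    have cA : {for x, continuous (fun _ : skorokhod E => \1_A ws : R)}.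
      exact: cst_continuous.
    have hx : h z @[z --> x] --> h x by exact: ch.
    have hj := cvg_comp _ _ hx (@exprn_continuous R j _).
    have c1 : {for x, continuous (fun _ : skorokhod E => 1 : R)} by exact: cst_continuous.
    exact: (continuousM cA (cvgB c1 hj)).
have ZA j : \int[Q]_w (Z w * phi j w) = 0.
  by apply: Zphi (sphi j) _ (phi1 j); apply/measurable_wrt_enlarged.
have : \int[Q]_w (Z w * phi j w) @[j --> \oo] --> \int[Q]_w (Z w * \1_B w).
  have hh := @bounded_cvg_Rintegral _ _ _ Q setT (fun j w => Z w * phi j w)
    (fun w => Z w * \1_B w) (C * 1) measurableT (probability_setT_lty Q).
  apply: hh.
  - by move=> j; apply: measurable_funM => //; case: (sphi j).
  - by apply: measurable_funM => //; exact: measurable_indic.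
  - by move=> j w _; rewrite normrM ler_pM.
  apply: aeW => w _; apply: cvgMr.
  have [wA|wA] := boolP (w.1 \in A); last first.
    rewrite /phi indicE (negbTE wA) [\1_B w]indicE.
    rewrite (_ : (w \in B) = false); last first.
      by apply: contraNF wA; rewrite BE !inE => -[].
    by under eq_fun do rewrite mul0r; exact: cvg_cst.
  have -> : \1_B w = (0 < psi w.2)%R%:R :> R.
    rewrite indicE; congr (nat_of_bool _)%:R; apply/idP/idP; rewrite BE inE.
      by case.
    move=> p0; by split=> //; rewrite inE in wA.
  rewrite /phi indicE wA; under eq_fun do rewrite mul1r.
  have := psi0 w.2; rewrite le_eqVlt => /predU1P[p0|p0].
    rewrite -p0 ltxx; apply: cvg_near_cst; apply: nearW => j.
    by rewrite /h -p0 oppr0 expR0 expr1n subrr.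
  have hj0 : h w.2 ^+ j @[j --> \oo] --> 0.
    apply: cvg_expr; have /andP[h0 _] := h01 w.2.
    by rewrite ger0_norm// /h -expR0 ltr_expR oppr_lt0.
  by have := cvgB (cvg_cst (1 : R)) hj0; rewrite p0 subr0; exact.
under eq_fun do rewrite ZA.
move=> /(cvg_unique _ (cvg_cst 0)) -> //.
rewrite Rintegral_mkcond; apply: eq_Rintegral => w _.
rewrite patchE indicE; case: ifPn => wB; rewrite ?mulr1 ?mulr0.
  by [].
by [].
Qed.

Let EZ (B : set Om) : measurable B ->
  (\int[Q]_(w in B) (Z w)%:E)%E = (\int[Q]_(w in B) Z w)%:E.
Proof.
move=> mB; have ft := integrable_fin_num mB (iZ mB).
exact (esym (fineK ft)).
Qed.

Lemma null_generated B : <<s test_sets Fs b >> B -> \int[Q]_(w in B) Z w = 0.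
Proof.
pose Tt := g_sigma_algebraType (test_sets Fs b : set (set Om)).
have mTt (A : set Om) : <<s test_sets Fs b >> A -> measurable A.
  move: A; apply: smallest_sub; first exact: sigma_algebra_measurable.
  exact: test_sets_measurable.
(* The whole space is the test set with [psi = 1]. Its zero integral settles complements in the
   Dynkin induction. *)
have ZT : \int[Q]_w Z w = 0.
  apply: null_test_sets; exists setT, (cst 1); split=> //.
  - exact: filtrationT.
  - exact: path_test1.
  - by apply/seteqP; split=> // w _; split=> //=.
apply: (@dynkin_induction _ Tt (test_sets Fs b) 
  (fun B : set Om => \int[Q]_(w in B) Z w = 0)) => //.
- exact: test_setsI.
- exact: null_test_sets.
- move=> S /mTt mS ZS; have mSc := measurableC mS.
  have := @Rintegral_setU _ _ _ Q S (~` S) Z mS mSc.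
  rewrite setUv ZT ZS add0r => <- //; first exact: iZ.
  by apply/disj_setPS; rewrite setICr.
- move=> F mF tF ZF.
  have mF' k : measurable (F k : set Om) by apply: mTt; exact: mF.
  have mUF : measurable (\bigcup_k F k : set Om) by exact: bigcupT_measurable.
  apply: EFin_inj; rewrite -EZ//.
  have := @integral_bigcup _ _ _ Q F (EFin \o Z) tF mF' (iZ mUF).
  move=> ->; apply: eseries0 => k _ _.
  by have := EZ (mF' k); rewrite ZF.
Qed.

End null_increment.

(** * The limit *)

Section stable_limit.
Context {R : realType} {E : polishType R} d {Os : measurableType d}.
Local Notation Om := (Os * skorokhod E)%type.
Variables (P : nat -> probability Om R) (Pinf : probability Om R).
Hypothesis P_cvg :
  (P n : stable_topology E Os) @[n --> \oo] --> (Pinf : stable_topology E Os).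

(** Stable tests are merely measurable in the first coordinate: the indicator of a cylinder over [A]
    is one, being constant in the path. *)
Lemma stable_limit_marginal (Ps : probability Os R) (A : set Os) :
  measurable A -> (forall n, P n (A `*` setT) = Ps A) -> Pinf (A `*` setT) = Ps A.
Proof.
move=> mA PA.
have mAT : measurable (A `*` setT : set Om) by exact: measurableX.
have st : stable_test (\1_(A `*` setT) : Om -> R).
  split; first exact: measurable_indic.
    by exists 1 => w _; rewrite indicE; case: (_ \in _); rewrite ?normr1 ?normr0.
  move=> ws; rewrite (_ : (fun _ => _) = cst (\1_A ws)); first exact: cst_continuous.
  apply/funext => x; rewrite !indicE; congr (nat_of_bool _)%:R.
  by apply/idP/idP; rewrite !inE => // -[].
have QA (Q : probability Om R) : \int[Q]_w \1_(A `*` setT) w = fine (Q (A `*` setT)).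
  by rewrite /Rintegral integral_indic// setIT.
have := stable_cvg_Rintegral P_cvg st.
rewrite QA; under eq_fun do rewrite QA PA.
move=> /(cvg_unique _ (cvg_cst _)) PAE.
have fPs : Ps A \is a fin_num by exact: fin_num_measure.
have fPinf : Pinf (A `*` setT) \is a fin_num by exact: fin_num_measure.
by rewrite -(fineK fPs) -(fineK fPinf) PAE.
Qed.

(** With [k] continuous, nonnegative and zero exactly at [x0], the almost sure initial condition
    says that [k (X_0)] has expectation zero. As evaluation at time [0] is continuous, this is a
    stable test, and the equality passes to the limit. *)
Lemma stable_limit_initial (x0 : E) :
  (forall n, P n [set w : Om | w.2 0 = x0] = 1%E) ->
  Pinf [set w : Om | w.2 0 = x0] = 1%E.
Proof.
move=> Px0.
have oO : open (~` [set x0]).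
  apply: closed_openC; apply: accessible_closed_set1; apply: hausdorff_accessible.
  exact: metric_hausdorff.
have [k [kc k1 k0 Ok]] := open_positive_fun oO.
pose S := [set w : Om | w.2 0 = x0].
pose xi (w : Om) := k (w.2 0).
have mev : measurable_fun setT (fun w : Om => w.2 0 : borel E).
  by apply: measurableT_comp (measurable_evaluation (lexx 0)) _; exact: measurable_snd.
have mxi : measurable_fun setT xi.
  exact: (measurableT_comp (continuous_borel_measurable kc) mev).
have st : stable_test xi.
  split=> //; first by exists 1 => w _; exact: k1.
  move=> ws; apply: skorokhod_sequential_continuous => x y xy.
  have yx := eval_cvg xy (lexx 0) (@continuous0 _ _ x).
  exact: (cvg_comp _ _ yx (kc (x 0))).
have SE : S = [set w | xi w = 0].
  apply/seteqP; split=> w /= => [w0|kw0].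
    apply/eqP; rewrite eq_le k0 andbT leNgt; apply/negP => kp.
    have : (~` [set x0]) (w.2 0) by rewrite Ok.
    exact.
  apply: contrapT => wx; have : (~` [set x0]) (w.2 0) by [].
  by rewrite Ok /= -/(xi w) kw0 ltxx.
have mS : measurable S.
  by rewrite SE -[X in measurable X]setTI; exact: (mxi measurableT [set 0]).
have QS (Q : probability Om R) : Q S = 1%E <-> \int[Q]_w xi w = 0.
  have ixi := bounded_integrable measurableT (probability_setT_lty Q) mxi
    (fun w _ => k1 (w.2 0)).
  have mexi : measurable_fun setT (EFin \o xi) by exact/measurable_EFinP.
  have QC : Q (~` S) = (1 - Q S)%E.
    exact: probability_setC.
  have aeP := ae_eq_integral_abs Q measurableT mexi.
  have absE : (\int[Q]_w `|(EFin \o xi) w|)%E = (\int[Q]_w xi w)%:E.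
    have ft := integrable_fin_num measurableT ixi.
    transitivity (\int[Q]_w (xi w)%:E)%E; last exact (esym (fineK ft)).
    by apply: eq_integral => w _; rewrite /= ger0_norm// k0.
  rewrite absE in aeP; split=> [QS1|xi0].
    apply: EFin_inj; apply/aeP.
    exists (~` S); split; first exact: measurableC.
      by have := QC; rewrite QS1 subee.
    by move=> w /= nw; rewrite SE /= => xi0; apply: nw; rewrite xi0.
  have /aeP aexi : (\int[Q]_w xi w)%:E = 0%E by rewrite xi0.
  have : Q (~` S) = 0%E.
    apply/(measure_negligible (measurableC mS)); apply: negligibleS aexi.
    by move=> w /=; rewrite SE /= => nw h; apply: nw; have := h I; case.
  rewrite QC => /eqP; rewrite sube_eq ?fin_num_measure//.
  by rewrite add0e => /eqP.
apply/QS; have := stable_cvg_Rintegral P_cvg st.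
under eq_fun => n do rewrite (iffLR (QS (P n)) (Px0 n)).
by move=> /(cvg_unique _ (cvg_cst _)) ->.
Qed.

End stable_limit.

Lemma limit_martingale (R : realType) (E U : polishType R) d (Os : measurableType d)
    (Fs : R -> set (set Os)) (hFs : filtration Fs) (f : E -> R) (g : coef E U) (Cf Cg : R)
    (fc : continuous f) (fC : forall e, `|f e| <= Cf) (mg : admissible_coef g)
    (gC : forall (s : R) x u e, 0 <= s -> `|g s x u e| <= Cg)
    (m : control U Os) (hm : control_process Fs m)
    (Q : probability (Os * skorokhod E)%type R) :
  (forall (b s t : R) (phi : Os * skorokhod E -> R) (K : R), 0 <= b -> b <= s -> s <= t ->
     stable_test phi -> measurable_wrt (enlarged_filtration Fs b) phi ->
     (forall w, `|phi w| <= K) ->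
     \int[Q]_w ((compensated f g m t w - compensated f g m s w) * phi w) = 0) ->
  martingale Q (enlarged_filtration Fs) (compensated f g m).
Proof.
move=> Qtest.
have mM t : 0 <= t -> measurable_fun setT (compensated f g m t).
  move=> t0; apply: (measurable_of_enlarged hFs t0).
  exact: (measurable_compensated_enlarged hFs fc mg gC hm t0).
have MC t w (t0 : 0 <= t) := normr_compensated hFs fC mg gC hm w t0.
split=> [t t0|t t0|s t A s0 st FA].
- apply/measurable_wrt_enlarged.
  exact: (measurable_compensated_enlarged hFs fc mg gC hm t0).
- exact: (bounded_integrable measurableT (probability_setT_lty Q) (mM _ t0)
    (fun w _ => MC _ w t0)).
have mA := enlarged_filtration_sub hFs s0 FA.
apply/(martingale_increment hFs fc fC mg gC hm Q s0 st mA).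
(* The case [s = t] is trivial and is set apart, since the times [b n] below must fit strictly after
   [s] and not beyond [t]. *)
move: st; rewrite le_eqVlt => /predU1P[->|st].
  by under eq_Rintegral do rewrite subrr; rewrite Rintegral_cst// mul0r.
(* Strictly after [s], so that the tests at [b n] generate the events known at [s]; at most [t], so
   that the increment from [b n] to [t] is covered; and tending to [s], so that right continuity
   recovers the increment from [s]. *)
pose b n := s + (t - s) / n.+1%:R.
have ts : 0 < t - s by rewrite subr_gt0.
have sb n : s < b n by rewrite ltrDl divr_gt0.
have b0 n : 0 <= b n by rewrite (le_trans s0)// ltW.
have bt n : b n <= t.
  by rewrite -lerBrDl ler_pdivrMr// ler_peMr ?ler1n// ltW.
have bs : b n @[n --> \oo] --> s.
  rewrite -[X in _ --> X]addr0; apply: cvgD; first exact: cvg_cst.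
  rewrite -(mulr0 (t - s)); apply: cvgM; first exact: cvg_cst.
  exact: cvg_harmonic.
have t0 := le_trans s0 (ltW st).
pose Z n w := compensated f g m t w - compensated f g m (b n) w.
have mZ n : measurable_fun setT (Z n) by apply: measurable_funB; exact: mM.
have ZC n w : `|Z n w| <= (Cf + Cg * t) + (Cf + Cg * t).
  rewrite (le_trans (ler_normB _ _))// lerD ?MC// (le_trans (MC _ _ (b0 n)))//.
  rewrite lerD2l ler_wpM2l//.
  by rewrite (le_trans _ (gC point point point point (lexx 0))).
have ZA n : \int[Q]_(w in A) Z n w = 0.
  apply: (null_generated hFs (b0 n) (mZ n) (ZC n)) => [phi K sphi mphi phiK|].
    exact: (Qtest (b n) (b n) t phi K).
  exact: (test_sets_generate hFs (b0 n) s0 (sb n)).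
have ZM : \int[Q]_(w in A) Z n w @[n --> \oo] -->
    \int[Q]_(w in A) (compensated f g m t w - compensated f g m s w).
  have QA : (Q A < +oo)%E.
    by rewrite (le_lt_trans (probability_le1 Q mA))// ltry.
  have h := @bounded_cvg_Rintegral _ _ _ Q A Z
    (fun w => compensated f g m t w - compensated f g m s w) _ mA QA.
  apply: h.
  - by move=> n; apply: measurable_funTS; exact: mZ.
  - by apply: measurable_funTS; apply: measurable_funB; exact: mM.
  - by move=> n w _; exact: ZC.
  apply: aeW => w _; apply: cvgB; first exact: cvg_cst.
  have := right_continuous_compensated hFs fc mg gC hm (w := w) s0.
  by move/cvg_at_rightP; apply.
move: ZM; under eq_fun do rewrite ZA.
by move=> /(cvg_unique _ (cvg_cst _)) <-.
Qed.

Theorem theorem4p2 (R : realType) (E U : polishType R)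
  (d : measure_display) (Os : measurableType d) (Ps : probability Os R)
  (Fs : R -> set (set Os)) (hFs : filtration Fs)
  (x0 : E)
  (G : set ((E -> R) * coef E U)) (hG : generator G)
  (g_bounded : forall f g, G (f, g) ->
    exists C : R, forall (t : R) x u e, 0 <= t -> `|g t x u e| <= C)
  (g_continuous : forall f g, G (f, g) -> forall (t : R) u, 0 <= t ->
    continuous (fun z : skorokhod E * E => g t z.1 u z.2))
  (m : nat -> control U Os) (minf : control U Os)
  (hm : forall n, control_process Fs (m n))
  (hminf : control_process Fs minf)
  (m_cvg : {ae Ps, forall w, control_cvg m minf w})
  (P : nat -> probability (Os * skorokhod E)%type R)
  (Pinf : probability (Os * skorokhod E)%type R)
  (hP : forall n, relaxed_rules Ps Fs G x0 (m n) (P n))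
  (P_cvg : (P n : stable_topology E Os) @[n --> \oo] --> (Pinf : stable_topology E Os))
  (drift_cvg : forall f g, G (f, g) -> forall s t : R, 0 <= s -> s <= t ->
    forall xi : Os * skorokhod E -> R,
      measurable_wrt (enlarged_filtration Fs s) xi -> bounded_on setT xi ->
      'E_(P n)[(fun w =>
        (\int[lebesgue_measure]_(r in `[s, t])
           (averaged_coef g (m n) r w - averaged_coef g minf r w)) * xi w)%R]%E
        @[n --> \oo] --> 0%E) :
  relaxed_rules Ps Fs G x0 minf Pinf.
Proof.
split=> [A mA|| f g Gfg].
- by apply: (stable_limit_marginal P_cvg) => // n; case: (hP n) => + _ _; apply.
- by apply: (stable_limit_initial P_cvg) => n; case: (hP n).
have [[fc [Cf fC]] mg] := hG _ _ Gfg.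
have {}fC e : `|f e| <= Cf by exact: fC.
have [Cg gC] := g_bounded _ _ Gfg.
have {}gC (s : R) x u e : 0 <= s -> `|g s x u e| <= Cg by exact: gC.
have gc := g_continuous _ _ Gfg.
apply: (limit_martingale hFs fc fC mg gC hminf) => b s t phi K b0 bs st sphi mphi phiK.
have Pm n : martingale (P n) (enlarged_filtration Fs) (compensated f g (m n)).
  by have [_ _ rules] := hP n; exact (rules f g Gfg).
exact: (limit_martingale_test hFs fc fC mg gC gc b0 sphi mphi phiK hm hminf Pm P_cvg
  (drift_cvg _ _ Gfg) bs st).
Qed.
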